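(* Let $(X,d,\mu)$ be a complete doubling metric measure space with relative lower mass bound exponent $Q:=Q_d>1$, and let $0<\theta<1$. Suppose that there exist constants $C\ge1$ and $\tau\ge1$ such that for any $\mu$-measurable set $U\subset X$ and any ball $B_0=B(x_0,r_0)\subset X$ satisfying $$\frac{\mu(U\cap B_0)}{\mu(B_0)}\le\frac12,$$ there exist a countable collection of pairwise disjoint balls $\{B_i\}_{i\in I}$, $I\subset\mathbb N$, with radii $r_i=\mathrm{rad}(B_i)=2^{-N_i}r_0$ for some $N_i\in\mathbb N\cup\{0\}$, and a set $\mathcal N\subset U$ with $\mu(\mathcal N)=0$, such that $$U\cap B_0\subset\mathcal N\cup\bigcup_{i\in I}5\tau B_i\quad\text{and}\quad\bigcup_{i\in I}B_i\subset\tau B_0,$$ and such that $$\sum_{i\in I}\frac{\mu(B_i)}{r_i^\theta}\le C(1-\theta)\,P_\theta(U,\tau B_0).$$ Then $(X,d,\mu)$ supports a $(\theta,q,1)_{BBM}$-Poincaré inequality for all $1\le q\le Q/(Q-\theta)$, with constants depending only on $C$, $\tau$, and the doubling constant.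
   Context: A metric measure space $(X,d,\mu)$ is a metric space with a Borel regular outer measure $\mu$. Balls $B(x,r)=\{y\in X:d(x,y)<r\}$ are open and come with a prescribed center and radius; for $B=B(x,r)$, $\lambda B:=B(x,\lambda r)$ and $\mathrm{rad}(B):=r$. The measure $\mu$ is doubling with constant $C_\mu\ge1$ if $0<\mu(B(x,2r))\le C_\mu\,\mu(B(x,r))<\infty$ for all $x\in X$, $r>0$. We write $u_B=\frac1{\mu(B)}\int_B u\,d\mu$. $L^1_{\mathrm{loc}}(X)$ consists of the functions integrable on every open set with compact closure (complete doubling spaces are proper, so equivalently on every ball). Relative lower mass bound exponent: if $\mu$ is doubling there exist $C_0\ge1$ and $Q_d>1$, depending only on $C_\mu$, such that $\frac{\mu(B(y,r))}{\mu(B(x,R))}\ge C_0^{-1}\left(\frac rR\right)^{Q_d}$ for all $x\in X$, $0<r\le R<\infty$, $y\in B(x,R)$; $Q_d$ denotes this (fixed) exponent. For $0<\theta<1$, measurable $E\subset X$ and open $\Omega\subset X$, the fractional $\theta$-perimeter is $$P_\theta(E,\Omega)=\int_{\Omega\cap E}\int_{\Omega\setminus E}\frac{2}{d(x,y)^\theta[\mu(B(x,d(x,y)))+\mu(B(y,d(x,y)))]}\,d\mu(y)\,d\mu(x).$$ $(X,d,\mu)$ supports a $(\theta,q,1)_{BBM}$-Poincaré inequality, with constants $C',\tau'\ge1$, if for all balls $B=B(x_0,r)$ and all $u\in L^1_{\mathrm{loc}}(X)$, $$\left(\frac1{\mu(B)}\int_B|u-u_B|^q\,d\mu\right)^{1/q}\le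 C'(1-\theta)r^\theta\frac1{\mu(\tau' B)}\int_{\tau' B}\int_{\tau' B}\frac{|u(x)-u(y)|}{d(x,y)^\theta\mu(B(x,d(x,y)))}\,d\mu(y)\,d\mu(x)$$ (the integrand being read as $0$ for $x=y$). *)

(* Defs.v *)
From HB Require Import structures.
From mathcomp Require Import all_boot all_order all_algebra.
From mathcomp Require Import all_classical all_reals all_analysis.

Set Implicit Arguments.
Unset Strict Implicit.
Unset Printing Implicit Defensive.

Import Order.TTheory GRing.Theory Num.Theory.

Local Open Scope classical_set_scope.
Local Open Scope ring_scope.
Local Open Scope ereal_scope.

(* The library equips a type with the Caratheodory sigma-algebra of an outer
   measure only when the type is pointed, hence the point. *)
#[short(type="pmetricType")]
HB.structure Definition PointedMetric (K : numDomainType) :=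
  {M of PseudoPointedMetric K M & PseudoMetric_isMetric K M}.

#[short(type="completeMetricType")]
HB.structure Definition CompleteMetric (K : numDomainType) :=
  {M of Complete M & PseudoPointedMetric K M & PseudoMetric_isMetric K M}.

Section metric_measure_space.
Context {R : realType} {X : pmetricType R}.
Implicit Types (mu : {outer_measure set X -> \bar R}).
Implicit Types (A B E Omega U : set X) (u : X -> R) (theta q : R).

Definition borel : set (set X) := <<s [set A : set X | open A] >>.

Definition borel_regular mu :=
  (forall A, borel A -> mu.-cara.-measurable A) /\
  (forall A, exists B, [/\ borel B, A `<=` B & mu B = mu A]).

Definition doubling mu (Cmu : R) :=
  forall (x : X) (r : R), (0 < r)%R ->
    [/\ 0 < mu (ball x (2 * r)%R),
        mu (ball x (2 * r)%R) <= Cmu%:E * mu (ball x r) &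
        Cmu%:E * mu (ball x r) < +oo].

Definition rel_lower_mass_bound mu (C0 Q : R) :=
  forall (x y : X) (r s : R), (0 < r)%R -> (r <= s)%R -> ball x s y ->
    (C0^-1 * (r / s) `^ Q)%:E <= mu (ball y r) / mu (ball x s).

(* Integration is over the Caratheodory sigma-algebra of mu, whose carrier
   [caratheodory_type mu] is convertible to X. *)
Definition cint mu A (f : X -> \bar R) : \bar R :=
  \int[mu : set (caratheodory_type mu) -> \bar R]_(x in A) f x.

Definition avg mu A (f : X -> \bar R) : \bar R := (mu A)^-1 * cint mu A f.

Definition L1loc mu u :=
  forall V : set X, open V -> compact (closure V) ->
    integrable (mu : set (caratheodory_type mu) -> \bar R) V (EFin \o u).

Definition perimeter mu theta E Omega : \bar R :=
  cint mu (Omega `&` E) (fun x => cint mu (Omega `\` E) (fun y =>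
    2%:E / ((mdist x y `^ theta)%:E *
            (mu (ball x (mdist x y)) + mu (ball y (mdist x y)))))).

Definition BBM_quotient mu theta u (x y : X) : \bar R :=
  if x == y then 0
  else `|u x - u y|%:E /
         ((mdist x y `^ theta)%:E * mu (ball x (mdist x y))).

Definition BBM_poincare mu theta q (C' tau' : R) :=
  forall (x0 : X) (r : R) (u : X -> R), (0 < r)%R -> L1loc mu u ->
    let B := ball x0 r in
    let tB := ball x0 (tau' * r)%R in
    let uB := fine (avg mu B (EFin \o u)) in
    (avg mu B (fun x => (`|u x - uB| `^ q)%:E)) `^ q^-1 <=
    (C' * (1 - theta) * r `^ theta)%:E *
    avg mu tB (fun x => cint mu tB (BBM_quotient mu theta u x)).

Definition boxing_property mu theta (C tau : R) :=
  forall (U : set X) (x0 : X) (r0 : R),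
    mu.-cara.-measurable U -> (0 < r0)%R ->
    mu (U `&` ball x0 r0) / mu (ball x0 r0) <= (2^-1)%:E ->
    exists (I : set nat) (c : nat -> X) (N : nat -> nat) (Z : set X),
      let r i : R := (2 ^- N i * r0)%R in
      [/\ trivIset I (fun i => ball (c i) (r i)),
          Z `<=` U /\ mu Z = 0,
          U `&` ball x0 r0 `<=`
            Z `|` \bigcup_(i in I) ball (c i) (5 * tau * r i)%R,
          \bigcup_(i in I) ball (c i) (r i) `<=` ball x0 (tau * r0)%R &
          \esum_(i in I) (mu (ball (c i) (r i)) / (r i `^ theta)%:E) <=
            (C * (1 - theta))%:E * perimeter mu theta U (ball x0 (tau * r0)%R)].

End metric_measure_space.

(* Main.v *)
Require Import Defs.
From HB Require Import structures.
From mathcomp Require Import all_boot all_order all_algebra.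
From mathcomp Require Import all_classical all_reals all_analysis.
From mathcomp Require Import measurable_realfun ring lra.

Set Implicit Arguments.
Unset Strict Implicit.
Unset Printing Implicit Defensive.

Import Order.TTheory GRing.Theory Num.Theory.

Local Open Scope classical_set_scope.
Local Open Scope ring_scope.
Local Open Scope ereal_scope.

(* Let B_i be the boxing balls of U and B0, with masses m_i = mu B_i / mu (tau B0)
   and S = \sum m_i <= 1.  The lower mass bound gives
   r_i^theta <= c r0^theta S^(theta/Q), so \sum mu B_i / r_i^theta controls
   S^(1 - theta/Q), and the boxing inequality becomes the isoperimetric inequality
   (mu (U & B0) / mu (tau B0))^(1/q) <= c (1 - theta) r0^theta P(U) / mu (tau B0).
   It is applied to the superlevel sets of u - c and c - u for a median c of u.
   By Tonelli the perimeters of these sets integrate to at most the double integral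
   J of the Poincare inequality (coarea), and phi(t) = mu {f >= t}^(1/q) is
   nonincreasing, so t phi(t) <= \int phi; hence
   \int f^q <= 2^q \int t^(q-1) phi(t)^q dt <= 2^q (\int phi)^q.
   The same estimate with exponent 1 replaces c by the mean of u.
   Tonelli needs the kernel to be measurable for the product sigma-algebra: doubling
   makes X separable, and (x, y) |-> mu (B(x, d(x, y))) is lower semicontinuous. *)

(** * Coarea inequality for a nonlocal energy *)

Section coarea.
Context {R : realType} (d : measure_display) (T : measurableType d).
Variable m : {sigma_finite_measure set T -> \bar R}.
Variables (v : T -> R) (k : T * T -> \bar R).
Hypotheses (mv : measurable_fun setT v) (mk : measurable_fun setT k).
Hypothesis k0 : forall z, 0 <= k z.

(** A single integrand in [((t, x), y)], so that both exchanges of integrals in [coarea] are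
    instances of Tonelli. *)
Let cross (w : R * T * T) : \bar R :=
  if ((v w.2 < w.1.1)%R && (w.1.1 <= v w.1.2)%R) then k (w.1.2, w.2) else 0.

Let cross_ge0 w : 0 <= cross w.
Proof. by rewrite /cross; case: ifP. Qed.

Let measurable_cross : measurable_fun setT cross.
Proof.
have m11 : measurable_fun setT (fun w : R * T * T => w.1.1).
  exact: (measurableT_comp measurable_fst measurable_fst).
have m12 : measurable_fun setT (fun w : R * T * T => w.1.2).
  exact: (measurableT_comp measurable_snd measurable_fst).
apply: measurable_fun_if => //.
- apply: measurable_and.
  + apply: measurable_fun_ltr m11.
    exact: (measurableT_comp mv measurable_snd).
  + apply: measurable_fun_ler m11 _.
    exact: (measurableT_comp mv m12).
- apply: measurable_funTS; apply: (measurableT_comp mk).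
  exact: measurable_fun_pair m12 measurable_snd.
Qed.

Definition level_energy (t : R) : \bar R :=
  \int[m]_(x in [set x | (t <= v x)%R])
    \int[m]_(y in [set y | (v y < t)%R]) k (x, y).

Let crossF : R * T -> \bar R := fubini_F m cross.

Let crossF_ge0 w : 0 <= crossF w.
Proof. by apply: integral_ge0. Qed.

Let measurable_crossF : measurable_fun setT crossF.
Proof. exact: (@measurable_fun_fubini_tonelli_F _ _ _ _ _ m cross). Qed.

Let level_energyE : level_energy = fubini_F m crossF.
Proof.
apply/funext => t.
rewrite /level_energy [LHS]integral_mkcond; apply: eq_integral => x _.
rewrite /crossF /fubini_F patchE; case: ifPn => [/set_mem/= tx|/negP tx].
  rewrite integral_mkcond; apply: eq_integral => y _.
  rewrite patchE /cross/= tx andbT; case: ifPn => [/set_mem/= -> //|/negP yt].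
  by case: ifPn => // yt'; exfalso; apply: yt; exact/mem_set.
rewrite integral0_eq// => y _; rewrite /cross/=.
by case: ifPn => // /andP[_ tx']; exfalso; apply: tx; exact/mem_set.
Qed.

Lemma measurable_level_energy : measurable_fun setT level_energy.
Proof.
rewrite level_energyE.
exact: (@measurable_fun_fubini_tonelli_F _ _ _ _ _ m crossF).
Qed.

(** Tonelli moves the integral in [t] innermost, first past [x] and then, for fixed [x], past [y].
    There it measures the levels that separate [v y] from [v x]. *)
Lemma coarea : \int[lebesgue_measure]_t level_energy t <=
  \int[m]_x \int[m]_y (`|v x - v y|%:E * k (x, y)).
Proof.
rewrite level_energyE.
rewrite (@fubini_tonelli _ _ _ _ _ lebesgue_measure m crossF)//.
have mdv : measurable_fun setT (fun z : T * T => `|v z.1 - v z.2|%:E * k z).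
  apply: emeasurable_funM => //; apply/measurable_EFinP.
  apply: measurableT_comp => //.
  by apply: measurable_funB; apply: measurableT_comp.
apply: ge0_le_integral => //.
- by move=> z _; apply: integral_ge0.
- exact: (@measurable_fun_fubini_tonelli_G _ _ _ _ _ lebesgue_measure crossF).
- apply: (@measurable_fun_fubini_tonelli_F _ _ _ _ _ m
    (fun z : T * T => `|v z.1 - v z.2|%:E * k z)) => //.
  by move=> z; rewrite mule_ge0.
move=> x _; rewrite /fubini_G /crossF /fubini_F.
have mcx : measurable_fun setT (fun z : R * T => cross (z.1, x, z.2)).
  apply: (measurableT_comp measurable_cross).
  apply: measurable_fun_pair measurable_snd.
  exact: measurable_fun_pair measurable_fst (measurable_cst _).
rewrite -/(fubini_F m (fun z : R * T => cross (z.1, x, z.2))).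
rewrite (@fubini_tonelli _ _ _ _ _ lebesgue_measure m
  (fun z : R * T => cross (z.1, x, z.2)))//.
apply: ge0_le_integral => //.
- by move=> z _; apply: integral_ge0.
- exact: (@measurable_fun_fubini_tonelli_G _ _ _ _ _ lebesgue_measure
    (fun z : R * T => cross (z.1, x, z.2))).
- exact: (measurableT_comp mdv (pair1_measurable x)).
move=> y _; rewrite /fubini_G/=.
(* The interval has length the positive part of [v x - v y], hence an inequality with the absolute
   value. *)
have -> : \int[lebesgue_measure]_t cross (t, x, y) =
    \int[lebesgue_measure]_(t in `]v y, v x]) k (x, y).
  rewrite [RHS]integral_mkcond; apply: eq_integral => t _.
  rewrite patchE /cross/=; congr (if _ then _ else _).
  by apply/idP/idP => [h|/set_mem//]; apply/mem_set; rewrite /= in_itv.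
rewrite integral_cst//= lebesgue_measure_itv/= lte_fin.
case: ifPn => yx; rewrite ?mule0 ?mule_ge0//.
by rewrite muleC -EFinB gtr0_norm// subr_gt0.
Qed.

End coarea.

(** * Strong estimate from a bound on superlevel sets *)

Section layer_cake.
Context {R : realType} (d : measure_display) (T : measurableType d).
Variables (m : {sigma_finite_measure set T -> \bar R}) (D : set T).
Variables (v : T -> R) (q : R) (G : R -> \bar R).
Hypotheses (mD : measurable D) (mv : measurable_fun setT v) (q1 : (1 <= q)%R).
Hypotheses (mG : measurable_fun setT G) (G0 : forall t, 0 <= G t).
Hypothesis hG : forall t, (0 < t)%R ->
  m (D `&` [set x | (t <= v x)%R]) `^ q^-1 <= G t.

Let superlevel t := D `&` [set x | (t <= v x)%R].

Let measurable_superlevel t : measurable (superlevel t).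
Proof.
by apply: measurableI => //; rewrite -[X in measurable X]setTI;
   exact: measurable_fun_ler.
Qed.

Let q0 : (0 < q)%R. Proof. exact: lt_le_trans q1. Qed.

(** The measure of [superlevel s] is nonincreasing in [s], so on []0, t]] its power [q^-1] is at
    least the value at [t], while [G] dominates it. *)
Let weak_type t : (0 < t)%R ->
  t%:E * m (superlevel t) `^ q^-1 <= \int[lebesgue_measure]_s G s.
Proof.
move=> t0.
have -> : t%:E * m (superlevel t) `^ q^-1 =
    \int[lebesgue_measure]_(s in `]0%R, t]) (m (superlevel t) `^ q^-1).
  rewrite integral_cst//= lebesgue_measure_itv/= lte_fin t0 sube0 muleC//.
apply: (@le_trans _ _ (\int[lebesgue_measure]_(s in `]0%R, t]) G s)); last first.
  by apply: ge0_subset_integral => //.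
apply: ge0_le_integral => //.
- by move=> s _; rewrite poweR_ge0.
- exact: measurable_funTS.
move=> s /=; rewrite in_itv/= => /andP[s0 st].
apply: le_trans (hG s0); apply: gt0_ler_poweR.
- by rewrite invr_ge0 ltW.
- by rewrite in_itv/= leey measure_ge0.
- by rewrite in_itv/= leey measure_ge0.
apply: le_measure; rewrite ?inE; try exact: measurable_superlevel.
by move=> x [Dx tx]; split => //=; exact: le_trans tx.
Qed.

Let g (w : R * T) : \bar R :=
  (\1_D w.2)%:E * if ((0 < w.1) && (w.1 <= v w.2))%R
                  then (w.1 `^ (q - 1))%:E else 0.

Let g_ge0 w : 0 <= g w.
Proof.
by rewrite /g mule_ge0//; case: ifP => // _; rewrite lee_fin powR_ge0.
Qed.

Let measurable_g : measurable_fun setT g.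
Proof.
apply: emeasurable_funM.
  apply/measurable_EFinP.
  apply: measurableT_comp measurable_snd; exact: measurable_indic.
apply: measurable_fun_if => //.
- apply: measurable_and.
  + by apply: measurable_fun_ltr => //; exact: measurable_fst.
  + apply: measurable_fun_ler; first exact: measurable_fst.
    exact: (measurableT_comp mv measurable_snd).
- apply: measurable_funTS; apply/measurable_EFinP.
  exact: (measurableT_comp (measurable_powR (q - 1)%R) measurable_fst).
Qed.

(** With [a] the measure of [superlevel t], the slice equals
    [t^(q-1) a = (t a^(1/q))^(q-1) a^(1/q)]. The first factor is bounded by [weak_type], the second
    by [hG]. *)
Let slice_le t : \int[lebesgue_measure]_s G s < +oo ->
  \int[m]_x g (t, x) <=
  (fine (\int[lebesgue_measure]_s G s) `^ (q - 1))%:E * G t.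
Proof.
move=> Jlty; have [t0|t0] := leP t 0%R.
  rewrite integral0_eq ?mule_ge0// ?lee_fin ?powR_ge0// => x _.
  by rewrite /g/= ltNge t0/= mule0.
have -> : \int[m]_x g (t, x) = (t `^ (q - 1))%:E * m (superlevel t).
  have <- : \int[m]_(x in superlevel t) (t `^ (q - 1))%:E =
      (t `^ (q - 1))%:E * m (superlevel t).
    by rewrite integral_cst//; exact: measurable_superlevel.
  rewrite [RHS]integral_mkcond; apply: eq_integral => x _.
  rewrite patchE /g/= t0/= indicE /superlevel in_setI.
  case: (x \in D); rewrite ?mul0e// mul1e/=.
  case: ifPn => tx; first by rewrite ifT//; exact/mem_set.
  by rewrite ifF//; apply/negP => /set_mem /=; exact/negP.
have mt0 : 0 <= m (superlevel t) by exact: measure_ge0.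
have wt := weak_type t0.
have h0 := hG t0.
move: mt0 wt h0; rewrite -/(superlevel t).
have J0 : 0 <= \int[lebesgue_measure]_s G s by exact: integral_ge0.
move: (m (superlevel t)) => [a| |]//.
- rewrite lee_fin poweR_EFin => a0 wt h0.
  have -> : a = ((a `^ q^-1) `^ (q - 1) * (a `^ q^-1))%R.
    by rewrite mulrC mulr_powRB1 ?powR_ge0// -powRrM mulVf ?gt_eqF// powRr1.
  rewrite -EFinM mulrA EFinM; apply: lee_pmul => //.
    by rewrite lee_fin mulr_ge0// powR_ge0.
    by rewrite lee_fin powR_ge0.
  rewrite lee_fin -powRM ?powR_ge0 ?(ltW t0)//; apply: ge0_ler_powR.
  + by rewrite subr_ge0.
  + by rewrite nnegrE mulr_ge0 ?powR_ge0// ltW.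
  + by rewrite nnegrE fine_ge0.
  + rewrite -lee_fin EFinM fineK// ge0_fin_numE//; exact: Jlty.
(* A superlevel set of infinite measure would make the integral of [G] infinite by [weak_type]. *)
- rewrite poweRyr ?invr_eq0 ?gt_eqF// gt0_muley ?lte_fin// => _.
  by rewrite leNgt Jlty.
Qed.

(** Up to [2^q], the power is bounded by the integral of [t^(q-1)] over []0, v x]]. After Tonelli,
    [slice_le] leaves [J^(q-1)] times the integral of [G], that is [J^q], where [J] is that
    integral. *)
Lemma layer_cake_le : \int[m]_(x in D) (Num.max (v x) 0 `^ q)%:E <=
  (2%:E * \int[lebesgue_measure]_t G t) `^ q.
Proof.
have J0 : 0 <= \int[lebesgue_measure]_s G s by exact: integral_ge0.
have [->|Joo] := eqVneq (\int[lebesgue_measure]_s G s) +oo.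
  by rewrite gt0_muley ?lte_fin// poweRyr ?gt_eqF// leey.
have Jfin : \int[lebesgue_measure]_s G s \is a fin_num.
  by rewrite ge0_fin_numE// ltey.
apply: (@le_trans _ _ (\int[m]_x ((2 `^ q)%:E * \int[lebesgue_measure]_t g (t, x)))).
  rewrite integral_mkcond; apply: ge0_le_integral => //.
  - by move=> x _; rewrite patchE; case: ifP => // _; rewrite lee_fin powR_ge0.
  - apply/(measurable_restrictT _ mD)/measurable_EFinP.
    apply: (@measurableT_comp _ _ _ _ _ _ (@powR R ^~ q)) => //.
    apply: measurable_funTS; apply: measurable_maxr => //.
  - apply: measurable_funeM.
    exact: (@measurable_fun_fubini_tonelli_G _ _ _ _ _ lebesgue_measure g).
  move=> x _; rewrite patchE; case: ifPn => Dx; last first.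
    by rewrite mule_ge0 ?lee_fin ?powR_ge0//; apply: integral_ge0.
  have [vx0|vx0] := leP (v x) 0%R.
    by rewrite powR0 ?gt_eqF// mule_ge0 ?lee_fin ?powR_ge0//; apply: integral_ge0.
  have v20 : (0 < v x / 2)%R by rewrite divr_gt0.
  (* On the upper half of []0, v x]] the function [t^(q-1)] is at least [(v x / 2)^(q-1)]. This half
     alone gives [(v x / 2)^q], so no antiderivative is computed. *)
  have -> : (v x `^ q)%:E = (2 `^ q)%:E *
      \int[lebesgue_measure]_(t in `](v x / 2)%R, v x]) ((v x / 2) `^ (q - 1))%:E.
    rewrite integral_cst//= lebesgue_measure_itv/= lte_fin ifT; last first.
      by lra.
    rewrite -EFinB -!EFinM; congr EFin.
    have -> : (v x - v x / 2 = v x / 2)%R by lra.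
    rewrite [((v x / 2) `^ _ * _)%R]mulrC mulr_powRB1// ?(ltW v20)//.
    by rewrite -powRM ?(ltW v20)// mulrC divfK.
  apply: lee_wpmul2l; first by rewrite lee_fin powR_ge0.
  rewrite integral_mkcond; apply: ge0_le_integral => //.
  - by move=> t _; rewrite patchE; case: ifP => // _; rewrite lee_fin powR_ge0.
  - have mI : measurable (`](v x / 2)%R, v x]%classic : set R) by [].
    by apply/(measurable_restrictT _ mI); exact: measurable_cst.
  - exact: (measurable_fun_pair1 _ measurable_g).
  move=> t _; rewrite patchE; case: ifPn => // /set_mem/=.
  rewrite in_itv/= => /andP[vt tv]; rewrite /g/= indicE Dx mul1e.
  rewrite tv (lt_trans v20 vt)/= lee_fin.
  by apply: ge0_ler_powR; rewrite ?nnegrE ?subr_ge0// ltW// (lt_trans v20 vt).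
rewrite ge0_integralZl//; last 2 first.
- exact: (@measurable_fun_fubini_tonelli_G _ _ _ _ _ lebesgue_measure g).
- by move=> x _; apply: integral_ge0.
rewrite -[X in _ * X](@fubini_tonelli _ _ _ _ _ lebesgue_measure m g)//.
rewrite poweRM// poweR_EFin; apply: lee_wpmul2l; first by rewrite lee_fin powR_ge0.
apply: le_trans (_ : \int[lebesgue_measure]_t
   ((fine (\int[lebesgue_measure]_s G s) `^ (q - 1))%:E * G t) <= _).
  apply: ge0_le_integral => //.
  - by move=> x _; apply: integral_ge0.
  - exact: (@measurable_fun_fubini_tonelli_F _ _ _ _ _ m g).
  - exact: measurable_funeM.
  - by move=> t _; apply: slice_le; rewrite ltey.
rewrite ge0_integralZl// ?lee_fin ?powR_ge0//.
rewrite -{2 3}(fineK Jfin) -EFinM poweR_EFin lee_fin mulrC mulr_powRB1//.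
exact: fine_ge0.
Qed.

End layer_cake.

(** * Elementary geometry of balls *)

Section balls.
Context {R : realType} {X : pmetricType R}.
Implicit Types (x y z : X) (r s e : R).

Lemma mem_ball x y r : ball x r y <-> (mdist x y < r)%R.
Proof. by rewrite ballEmdist. Qed.

Lemma ball_subset_center x y r s :
  (mdist y x + r <= s)%R -> ball x r `<=` ball y s.
Proof.
move=> rs z /mem_ball xz; apply/mem_ball.
by rewrite (le_lt_trans (metric_triangle _ x _))//; lra.
Qed.

Lemma ball_subset_radius x r s : (r <= s)%R -> ball x r `<=` ball x s.
Proof. by move=> rs; apply: ball_subset_center; rewrite mdistxx add0r. Qed.

Lemma open_mball x r : open (ball x r).
Proof.
rewrite openE => y /mem_ball xy; apply/nbhs_ballP.
exists (r - mdist x y)%R => /=; first by rewrite subr_gt0.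
by apply: ball_subset_center; lra.
Qed.

Lemma closure_ball_subset x r s : (r < s)%R -> closure (ball x r) `<=` ball x s.
Proof.
move=> rs y /(_ (ball y (s - r))); case.
  by apply: nbhsx_ballx; rewrite subr_gt0.
move=> z [/mem_ball xz /mem_ball yz]; apply/mem_ball.
rewrite (le_lt_trans (metric_triangle _ z _))//.
by rewrite [mdist z y]metric_sym; lra.
Qed.

End balls.

(** * Finite nets, separability and measurable sets of the product *)

Section doubling_space.
Context {R : realType} {X : pmetricType R}.
Variables (mu : {outer_measure set X -> \bar R}) (Cmu C0 Q : R).
Hypotheses (Cmu1 : (1 <= Cmu)%R) (C01 : (1 <= C0)%R).
Hypotheses (mu_reg : borel_regular mu) (mu_dbl : doubling mu Cmu).
Hypothesis mu_lmb : rel_lower_mass_bound mu C0 Q.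
Implicit Types (x y z : X) (r s e : R).

Let M := caratheodory_type mu.

Lemma measurable_open (A : set X) : open A -> mu.-cara.-measurable A.
Proof. by move=> oA; apply: mu_reg.1; exact: sub_sigma_algebra. Qed.

Lemma measurable_mball x r : mu.-cara.-measurable (ball x r).
Proof. exact/measurable_open/open_mball. Qed.

Lemma mu_ball_gt0 x r : (0 < r)%R -> 0 < mu (ball x r).
Proof.
move=> r0; have [+ _ _] := mu_dbl x (divr_gt0 r0 (@ltr0n R 2)).
by rewrite mulrC divfK.
Qed.

Lemma mu_ball_fin_num x r : mu (ball x r) \is a fin_num.
Proof.
rewrite ge0_fin_numE ?outer_measure_ge0//.
have r1 : (0 < `|r| + 1)%R by rewrite ltr_wpDl.
apply: (@le_lt_trans _ _ (mu (ball x (`|r| + 1)))).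
  by apply/le_outer_measure/ball_subset_radius; rewrite ler_wpDr// ler_norm.
have [_ _] := mu_dbl x r1; apply: le_lt_trans.
by rewrite lee_pemull// outer_measure_ge0.
Qed.

Lemma fine_mu_ball_gt0 x r : (0 < r)%R -> (0 < fine (mu (ball x r)))%R.
Proof.
by move=> r0; rewrite fine_gt0// mu_ball_gt0//= ltey_eq mu_ball_fin_num.
Qed.

Lemma mu_ball_expand n x r s : (0 < r)%R -> (s <= 2 ^+ n * r)%R ->
  mu (ball x s) <= (Cmu ^+ n)%:E * mu (ball x r).
Proof.
move=> r0 sr; apply: le_trans (_ : mu (ball x (2 ^+ n * r)) <= _).
  exact/le_outer_measure/ball_subset_radius.
elim: n {sr} => [|n IHn]; first by rewrite !expr0 mul1r mul1e.
rewrite !exprS -mulrA.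
have [_ + _] := mu_dbl x (mulr_gt0 (exprn_gt0 n (@ltr0n R 2)) r0).
move=> /le_trans; apply; rewrite EFinM -muleA.
by apply: lee_wpmul2l => //; rewrite lee_fin (le_trans _ Cmu1).
Qed.

(** Without a finite net, arbitrarily many [e]-separated points can be chosen in the ball. The balls
    of radius [h] around them are disjoint, have mass at least [c] by the lower mass bound, and lie
    in [ball x (r + h)], whose measure is finite. *)
Lemma totally_bounded_ball x r e : (0 < e)%R ->
  exists s : seq X, ball x r `<=` \bigcup_(y in [set` s]) ball y e.
Proof.
move=> e0; have [r0|r0] := leP r 0%R.
  exists [::] => y /mem_ball; rewrite ltNge (le_trans r0)//; exact: mdist_ge0.
apply: contrapT => /forallNP no_net.
(* [h <= e / 2] makes the packed balls disjoint; [h <= r] is required by the lower mass bound. *)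
pose h := Num.min (e / 2)%R r.
have h0 : (0 < h)%R by rewrite lt_min r0 divr_gt0.
have hr : (h <= r)%R by rewrite ge_min lexx orbT.
have he : (h <= e / 2)%R by rewrite ge_min lexx.
pose c := (fine (mu (ball x r)) * (C0^-1 * (h / r) `^ Q))%R.
have c0 : (0 < c)%R.
  rewrite mulr_gt0 ?fine_mu_ball_gt0// mulr_gt0 ?invr_gt0 ?(lt_le_trans _ C01)//.
  by rewrite powR_gt0// divr_gt0.
have mass y : ball x r y -> c%:E <= mu (ball y h).
  move=> xy; have := mu_lmb h0 hr xy.
  rewrite -(fineK (mu_ball_fin_num y h)) -(fineK (mu_ball_fin_num x r)).
  rewrite inver gt_eqF ?fine_mu_ball_gt0// -EFinM !lee_fin.
  by rewrite ler_pdivlMr ?fine_mu_ball_gt0// mulrC.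
have [n nbig] : exists n : nat, (fine (mu (ball x (r + h))) < n%:R * c)%R.
  exists (Num.bound (fine (mu (ball x (r + h))) / c)).
  rewrite -ltr_pdivrMr//; apply: archi_boundP.
  by rewrite divr_ge0 ?(ltW c0)// fine_ge0// outer_measure_ge0.
have packing : exists2 s : seq X, [set` s] `<=` ball x r &
    (n%:R * c)%:E <= mu (\bigcup_(y in [set` s]) ball y h).
  elim: n {nbig} => [|n [s sx IHn]].
    by exists [::] => //; rewrite mul0r outer_measure_ge0.
  have [z [xz sz]] : exists z, ball x r z /\ forall y, y \in s -> ~ ball y e z.
    have /existsNP[z /not_implyP[xz sz]] := no_net s.
    by exists z; split => // y ys yz; apply: sz; exists y.
  exists (z :: s).
    by move=> y /=; rewrite inE => /predU1P[->//|/sx].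
  have -> : [set` z :: s] = [set z] `|` [set` s].
    apply/seteqP; split=> y /=; rewrite inE; first by move/predU1P.
    by case=> [->|->]; rewrite ?eqxx ?orbT.
  rewrite bigcup_setU bigcup_set1.
  have := @measureU _ _ _ (mu : {measure set M -> \bar R})
    (ball z h) (\bigcup_(y in [set` s]) ball y h).
  move=> ->.
  - rewrite -natr1 mulrDl mul1r addrC EFinD leeD//; exact: mass.
  - exact: measurable_mball.
  - apply: measurable_open; apply: bigcup_open => y _; exact: open_mball.
  - rewrite -subset0 => w [/mem_ball zw [y /= ys /mem_ball yw]].
    apply: (sz y ys); apply/mem_ball.
    rewrite (le_lt_trans (metric_triangle _ w _))//.
    by rewrite [mdist w z]metric_sym; lra.
have [s sx] := packing; apply/negP; rewrite -ltNge.
apply: le_lt_trans (_ : _ <= mu (ball x (r + h))) _; last first.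
  by rewrite -(fineK (mu_ball_fin_num _ _)) lte_fin.
apply: le_outer_measure => w [y /= /sx /mem_ball xy].
by apply: ball_subset_center; rewrite lerD2r ltW.
Qed.

Lemma countable_dense : exists s : nat * nat -> X,
  forall x r, (0 < r)%R -> exists i, ball (s i) r x.
Proof.
pose x0 : X := point.
have /choice[L HL] : forall n : nat, exists s : seq X,
    ball x0 n%:R `<=` \bigcup_(y in [set` s]) ball y n.+1%:R^-1.
  by move=> n; apply: totally_bounded_ball; rewrite invr_gt0.
(* The index [(n, j)] is the [j]-th point of a net of mesh [1/(n+1)] for [ball x0 n]; past its end
   [nth] returns [x0], which does no harm. Below, [n] is large enough both to catch [x] and to make
   the mesh at most [r]. *)
exists (fun i => nth x0 (L i.1) i.2) => x r r0.
pose n := maxn (Num.bound (mdist x0 x)) (Num.bound r^-1%R).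
have /HL[y /= yL yx] : ball x0 n%:R x.
  apply/mem_ball; apply: (@lt_le_trans _ _ (Num.bound (mdist x0 x))%:R).
    by apply: archi_boundP; exact: mdist_ge0.
  by rewrite ler_nat leq_maxl.
exists (n, index y (L n)); rewrite /= nth_index//.
apply: ball_subset_radius yx.
rewrite invf_ple ?posrE//; apply: (@le_trans _ _ (Num.bound r^-1)%:R).
  by apply/ltW/archi_boundP; rewrite invr_ge0 ltW.
by rewrite ler_nat; apply: leqW; rewrite leq_maxr.
Qed.

Lemma sigma_finite_mu : sigma_finite [set: M] mu.
Proof.
exists (fun n => ball (point : X) n%:R); last first.
  by move=> n; split; [exact: measurable_mball|rewrite ltey_eq mu_ball_fin_num].
apply/seteqP; split => // x _.
exists (Num.bound (mdist (point : X) x)) => //.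
by apply/mem_ball/archi_boundP; exact: mdist_ge0.
Qed.

(** The hypothesis spells out openness in the product. By separability [W] is a countable union of
    rectangles of balls with centres in the dense sequence and radii [1/(k+1)], and these rectangles
    are measurable. *)
Lemma measurable_prod_open (W : set (M * M)) :
  (forall x y, W (x, y) -> exists2 r : R, (0 < r)%R &
     forall x' y', ball (x : X) r x' -> ball (y : X) r y' -> W (x', y')) ->
  measurable W.
Proof.
move=> oW; have [s sd] := countable_dense.
pose P (i : nat * nat * (nat * nat) * nat) : set (M * M) :=
  ball (s i.1.1) i.2.+1%:R^-1 `*` ball (s i.1.2) i.2.+1%:R^-1.
have -> : W = \bigcup_i (if pselect (P i `<=` W) then P i else set0).
  apply/seteqP; split => [[x y] /oW[r r0 rW]|z [i _]]; last first.
    by case: pselect => // PW /PW.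
  pose k := Num.bound (2 / r)%R.
  have k0 : (0 < k.+1%:R^-1 :> R)%R by rewrite invr_gt0.
  (* A ball of radius [1/(k+1)] that contains [x] then lies in [ball x r]. *)
  have kr : (k.+1%:R^-1 + k.+1%:R^-1 <= r)%R.
    suff : (2 / k.+1%:R <= r)%R by move: (k.+1%:R^-1)%R => a; lra.
    rewrite ler_pdivrMr// mulrC -ler_pdivrMr//.
    apply: (@le_trans _ _ k%:R); last by rewrite ler_nat.
    by apply/ltW/archi_boundP; rewrite divr_ge0// ltW.
  have [i ix] := sd x _ k0; have [j jy] := sd y _ k0.
  have Pij : P ((i, j), k) `<=` W.
    move=> [x' y'] [/= ix' jy']; apply: rW.
    - apply: ball_subset_radius kr _ _; apply: ball_triangle ix'; exact: ball_sym.
    - apply: ball_subset_radius kr _ _; apply: ball_triangle jy'; exact: ball_sym.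
  by exists ((i, j), k) => //; case: pselect.
apply: countable_bigcupT_measurable => // i; case: pselect => [?|?]; last exact: measurable0.
by apply: measurableX; exact: measurable_mball.
Qed.

End doubling_space.

(** * Two measurability criteria for real functions *)

Lemma measurable_fun_superlevel {R : realType} (d : measure_display)
    (T : measurableType d) (f : T -> R) :
  (forall a, measurable [set z | (a < f z)%R]) -> measurable_fun setT f.
Proof.
move=> mf; apply: (measurability _ (RGenOInfty.measurableE R)) => //.
move=> _ [_ [a ->] <-]; rewrite setTI.
by rewrite (_ : _ @^-1` _ = [set z | (a < f z)%R])//; apply/seteqP; split=> z /=;
   rewrite in_itv/= andbT.
Qed.

Lemma measurable_fun_invr {R : realType} (d : measure_display)
    (T : measurableType d) (f : T -> R) : (forall z, 0 <= f z)%R ->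
  measurable_fun setT f -> measurable_fun setT (fun z => (f z)^-1)%R.
Proof.
move=> f0 mf; rewrite (_ : (fun z => _) = (fun z => f z `^ (-1))%R).
  exact: (measurableT_comp (measurable_powR (-1)%R) mf).
by apply/funext => z; rewrite powR_inv1.
Qed.

(* An alias, because an outer measure only becomes sigma-finite under the
   doubling hypothesis, which the instance has to carry. *)
Section sigma_finite_copy.
Context {R : realType} (d : measure_display) (T : measurableType d).
Variable m : {measure set T -> \bar R}.

Definition sigma_finite_copy of sigma_finite setT m : set T -> \bar R := m.

Variable sf : sigma_finite setT m.
HB.instance Definition _ := Measure.on (sigma_finite_copy sf).
HB.instance Definition _ :=
  Measure_isSigmaFinite.Build _ _ _ (sigma_finite_copy sf) sf.

End sigma_finite_copy.

(** * Measurable kernels and the coarea inequality for the perimeter *)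

Section kernels.
Context {R : realType} {X : pmetricType R}.
Variables (mu : {outer_measure set X -> \bar R}) (Cmu C0 Q : R).
Hypotheses (Cmu1 : (1 <= Cmu)%R) (C01 : (1 <= C0)%R).
Hypotheses (mu_reg : borel_regular mu) (mu_dbl : doubling mu Cmu).
Hypothesis mu_lmb : rel_lower_mass_bound mu C0 Q.
Variable theta : R.
Hypothesis theta0 : (0 < theta)%R.
Implicit Types (x y : X) (r s e : R).

Let M := caratheodory_type mu.
Let sf := sigma_finite_mu Cmu1 mu_reg mu_dbl.
Let m : {sigma_finite_measure set M -> \bar R} :=
  @sigma_finite_copy R _ M (mu : {measure set M -> \bar R}) sf.

Let bm (z : M * M) : R := fine (mu (ball (z.1 : X) (mdist (z.1 : X) z.2))).

Let bm_ge0 z : (0 <= bm z)%R.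
Proof. by apply: fine_ge0; exact: outer_measure_ge0. Qed.

Let dist (z : M * M) : R := mdist (z.1 : X) z.2.

Let dist_near x y x' y' : (mdist x y <= mdist x x' + dist (x', y') + mdist y y')%R.
Proof.
rewrite /dist/= (le_trans (metric_triangle _ x' _))// -addrA lerD2l.
by rewrite (le_trans (metric_triangle _ y' _))// lerD2l metric_sym.
Qed.

Let measurable_dist : measurable_fun setT dist.
Proof.
apply: measurable_fun_superlevel => a.
apply: (measurable_prod_open Cmu1 C01 mu_reg mu_dbl mu_lmb) => x y /= axy.
exists ((mdist (x : X) y - a) / 2)%R; first by rewrite divr_gt0// subr_gt0.
move=> x' y' /mem_ball xx' /mem_ball yy'; have := dist_near x y x' y'.
by rewrite /dist/= in axy *; lra.
Qed.

(** An open ball is the increasing union of the concentric balls of radii [r - 1/(n+1)], and [mu] is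
    continuous from below. *)
Let mu_ball_inner x r (a : \bar R) : a < mu (ball x r) ->
  exists2 e, (0 < e)%R & a < mu (ball x (r - e)).
Proof.
pose F (n : nat) : set M := ball x (r - n.+1%:R^-1)%R.
have FE : \bigcup_n F n = ball x r.
  apply/seteqP; split => y.
    by move=> [n _]; apply: ball_subset_radius; rewrite gerBl.
  move=> /mem_ball xy; pose n := Num.bound (r - mdist x y)^-1%R.
  exists n => //; apply/mem_ball; rewrite ltrBrDr addrC -ltrBrDr.
  rewrite invf_plt ?posrE ?subr_gt0//.
  apply: (@lt_le_trans _ _ n%:R); last by rewrite ler_nat.
  by apply: archi_boundP; rewrite invr_ge0 subr_ge0 ltW.
have mF n : measurable (F n) by exact: measurable_mball.
have ndF : nondecreasing_seq F.
  move=> i j ij; apply/subsetPset; apply: ball_subset_radius.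
  by rewrite lerD2l lerN2 lef_pV2 ?posrE// ler_nat.
have := @nondecreasing_cvg_mu _ _ _ m F mF (bigcupT_measurable _ mF) ndF.
rewrite FE => muF; apply: contraPP => noe; apply/negP; rewrite -leNgt.
rewrite -[leLHS]/(m (ball x r)) -(cvg_lim _ muF)//; apply: lime_le.
  by apply/cvg_ex; exists (m (ball x r)).
apply: nearW => n; rewrite leNgt; apply/negP => aFn; apply: noe.
by exists n.+1%:R^-1%R => //; rewrite invr_gt0.
Qed.

(** Lower semicontinuity: a slightly smaller ball still has measure above [a], and it stays inside
    the ball given by any nearby pair. *)
Let measurable_bm : measurable_fun setT bm.
Proof.
apply: measurable_fun_superlevel => a.
apply: (measurable_prod_open Cmu1 C01 mu_reg mu_dbl mu_lmb) => x y /= axy.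
have : a%:E < mu (ball (x : X) (mdist (x : X) y)).
  by rewrite -(fineK (mu_ball_fin_num Cmu1 mu_dbl _ _)) lte_fin.
(* One third pays for moving the centre, two thirds for the change of the distance. *)
move=> /mu_ball_inner[e e0 ae]; exists (e / 3)%R; first by rewrite divr_gt0.
move=> x' y' /mem_ball xx' /mem_ball yy'; have := dist_near x y x' y'.
rewrite /dist/= => dxy; rewrite -lte_fin fineK ?(mu_ball_fin_num Cmu1 mu_dbl)//.
apply: (lt_le_trans ae); apply/le_outer_measure/ball_subset_center.
by rewrite metric_sym; lra.
Qed.

Variable D : set M.
Hypothesis mD : measurable D.

(** The indicators turn integrals over [D] into integrals over the whole space. The parameter [b] is
    one ball measure for the Poincare kernel, the sum of two for the perimeter kernel. *)
Let kpair (b : M * M -> R) (z : M * M) : R :=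
  (\1_D z.1 * \1_D z.2 * (dist z `^ theta * b z)^-1)%R.

Let measurable_kpair (b : M * M -> R) : (forall z, 0 <= b z)%R -> measurable_fun setT b ->
  measurable_fun setT (kpair b).
Proof.
move=> b0 mb; apply: measurable_funM; first apply: measurable_funM.
- by apply: measurableT_comp measurable_fst; exact: measurable_indic.
- by apply: measurableT_comp measurable_snd; exact: measurable_indic.
apply: measurable_fun_invr => [z|]; first by rewrite mulr_ge0// powR_ge0.
apply: measurable_funM => //.
exact: (measurableT_comp (measurable_powR theta) measurable_dist).
Qed.

Let bmT (z : M * M) : R := bm (z.2, z.1).

Let bmTE x y : bmT (x, y) = fine (mu (ball y (mdist x y))).
Proof. by rewrite /bmT /bm/= metric_sym. Qed.

Let ksym (z : M * M) : \bar R := (2 * kpair (bm \+ bmT)%R z)%:E.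

Let ksym_ge0 z : 0 <= ksym z.
Proof.
rewrite lee_fin mulr_ge0// /kpair !mulr_ge0// invr_ge0 mulr_ge0 ?powR_ge0//.
by apply: addr_ge0; exact: bm_ge0.
Qed.

(** Dropping the second ball shrinks the denominator. On the diagonal both sides vanish, since
    [0 ^ theta = 0] and the real inverse of [0] is [0]. *)
Let ksym_le x y : (2 * kpair (bm \+ bmT) (x, y) <= 2 * kpair bm (x, y))%R.
Proof.
apply: ler_wpM2l => //; apply: ler_wpM2l; first by rewrite mulr_ge0.
have [->|xy] := eqVneq x y.
  by rewrite /dist/= mdistxx powR0 ?gt_eqF// !mul0r.
have d0 : (0 < mdist x y)%R by rewrite mdist_gt0.
have p0 : (0 < dist (x, y) `^ theta)%R by rewrite powR_gt0.
have b0 : (0 < bm (x, y))%R by exact: (fine_mu_ball_gt0 Cmu1 mu_dbl).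
have bT0 : (0 <= bmT (x, y))%R by exact: bm_ge0.
rewrite lef_pV2 ?posrE; last 2 first.
- by rewrite mulr_gt0// ltr_pwDl.
- by rewrite mulr_gt0.
by apply: ler_wpM2l; rewrite ?(ltW p0)// lerDl.
Qed.

Let measurable_ksym : measurable_fun setT ksym.
Proof.
apply/measurable_EFinP; apply: measurable_funM => //; apply: measurable_kpair.
  by move=> z; apply: addr_ge0; exact: bm_ge0.
apply: measurable_funD => //; apply: (measurableT_comp measurable_bm).
exact: measurable_fun_pair measurable_snd measurable_fst.
Qed.

Variables (v : M -> R).
Hypothesis mv : measurable_fun setT v.

Definition perimeter_superlevel t : \bar R :=
  perimeter mu theta (D `&` [set x | (t <= v x)%R]) D.

(** The kernels are compared only where [v y < t <= v x]. There [x] and [y] differ, the denominator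
    is positive, and the extended inverse is the real one. *)
Let perimeter_superlevelE : perimeter_superlevel = level_energy m v ksym.
Proof.
apply/funext => t; rewrite /perimeter_superlevel /perimeter /level_energy /cint.
rewrite -/M [LHS]integral_mkcond [RHS]integral_mkcond.
apply: eq_integral => x _; rewrite !patchE.
have [Dx|Dx] := boolP (x \in D); last first.
  rewrite ifF; last by apply/negP => /set_mem[Dx' _]; move/negP: Dx; apply; exact/mem_set.
  case: ifP => // _; rewrite integral0_eq// => y _.
  by rewrite /ksym /kpair/= indicE (negPf Dx) !mul0r mulr0.
have [tx|tx] := leP t (v x); last first.
  by rewrite !ifF//; apply/negP => /set_mem/=; rewrite leNgt tx// => -[_ []].
rewrite !ifT; [|exact/mem_set|]; last first.
  by apply/mem_set; split; [exact: set_mem|split => //; exact: set_mem].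
rewrite [LHS]integral_mkcond [RHS]integral_mkcond; apply: eq_integral => y _.
rewrite !patchE.
have [Dy|Dy] := boolP (y \in D); last first.
  rewrite ifF; last by apply/negP => /set_mem[Dy' _]; move/negP: Dy; apply; exact/mem_set.
  by case: ifP => // _; rewrite /ksym /kpair/= !indicE (negPf Dy) mulr0 mul0r mulr0.
have [ty|ty] := leP t (v y).
  by rewrite !ifF//; apply/negP => /set_mem/=; rewrite ?ltNge ty// => -[? []].
rewrite !ifT; [|exact/mem_set|]; last first.
  apply/mem_set; split; first exact: set_mem.
  by move=> [_] /=; rewrite leNgt ty.
have xy : (0 < mdist (x : X) y)%R.
  rewrite mdist_gt0; apply: contraTneq tx => ->; by rewrite leNgt ty.
rewrite /ksym /kpair/= !indicE Dx Dy !mul1r bmTE /bm/=.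
rewrite -(fineK (mu_ball_fin_num Cmu1 mu_dbl x _)).
rewrite -(fineK (mu_ball_fin_num Cmu1 mu_dbl y _)).
rewrite -EFinD -EFinM inver gt_eqF//.
by rewrite mulr_gt0 ?powR_gt0// addr_gt0// (fine_mu_ball_gt0 Cmu1 mu_dbl).
Qed.

Lemma measurable_perimeter_superlevel : measurable_fun setT perimeter_superlevel.
Proof. by rewrite perimeter_superlevelE; exact: measurable_level_energy. Qed.

(** This is [coarea] for the kernel [ksym], followed by [ksym_le]. The factor 2 is the numerator of
    the perimeter kernel. *)
Lemma coarea_perimeter : \int[lebesgue_measure]_t perimeter_superlevel t <=
  2%:E * cint mu D (fun x => cint mu D (BBM_quotient mu theta v x)).
Proof.
rewrite perimeter_superlevelE; apply: le_trans (coarea m mv measurable_ksym ksym_ge0) _.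
pose w (z : M * M) : \bar R := (`|v z.1 - v z.2| * kpair bm z)%:E.
have w0 z : 0 <= w z.
  by rewrite lee_fin !mulr_ge0// invr_ge0 mulr_ge0// powR_ge0.
have mdv : measurable_fun setT (fun z : M * M => `|v z.1 - v z.2|)%R.
  apply: (@measurableT_comp _ _ _ _ _ _ (@Num.norm R R)) => //.
  apply: measurable_funB.
  - exact: (measurableT_comp mv measurable_fst).
  - exact: (measurableT_comp mv measurable_snd).
have mw : measurable_fun setT w.
  apply/measurable_EFinP; apply: measurable_funM => //; exact: measurable_kpair.
have -> : cint mu D (fun x => cint mu D (BBM_quotient mu theta v x)) =
    \int[m]_x fubini_F m w x.
  rewrite /cint -/M [LHS]integral_mkcond; apply: eq_integral => x _.
  rewrite patchE /fubini_F /w /kpair/=.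
  case: ifPn => Dx; last first.
    by rewrite integral0_eq// => y _; rewrite indicE (negPf Dx) !mul0r mulr0.
  rewrite integral_mkcond; apply: eq_integral => y _; rewrite patchE.
  case: ifPn => Dy; last by rewrite !indicE (negPf Dy) mulr0 mul0r mulr0.
  rewrite /BBM_quotient !indicE Dx Dy !mul1r.
  have [->|xy] := eqVneq x y; first by rewrite subrr normr0 mul0r.
  rewrite /bm /dist/= -(fineK (mu_ball_fin_num Cmu1 mu_dbl x _)).
  have d0 : (0 < mdist (x : X) y)%R by rewrite mdist_gt0.
  rewrite -EFinM inver gt_eqF// mulr_gt0 ?powR_gt0// (fine_mu_ball_gt0 Cmu1 mu_dbl)//.
rewrite -ge0_integralZl//; last 2 first.
- exact: (@measurable_fun_fubini_tonelli_F _ _ _ _ _ m w).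
- by move=> x _; exact: integral_ge0.
have ml : measurable_fun setT (fun z : M * M => `|v z.1 - v z.2|%:E * ksym z).
  by apply: emeasurable_funM => //; exact/measurable_EFinP.
apply: ge0_le_integral => //.
- by move=> x _; apply: integral_ge0 => y _; rewrite mule_ge0.
- apply: (@measurable_fun_fubini_tonelli_F _ _ _ _ _ m
    (fun z : M * M => `|v z.1 - v z.2|%:E * ksym z)) => // z.
  by rewrite mule_ge0.
- apply: measurable_funeM.
  exact: (@measurable_fun_fubini_tonelli_F _ _ _ _ _ m w).
move=> x _; rewrite /fubini_F -ge0_integralZl//; last first.
  exact: (measurableT_comp mw (pair1_measurable x)).
apply: ge0_le_integral => //.
- by move=> y _; rewrite mule_ge0.
- exact: (measurableT_comp ml (pair1_measurable x)).
- apply: measurable_funeM.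
  exact: (measurableT_comp mw (pair1_measurable x)).
move=> y _; rewrite /ksym /w -!EFinM lee_fin.
by rewrite [leRHS]mulrCA; exact: ler_wpM2l (normr_ge0 _) _ _ (ksym_le x y).
Qed.

End kernels.

(** * Isoperimetric inequality from the boxing property *)

Lemma perimeter_ge0 {R : realType} {X : pmetricType R}
    (mu : {outer_measure set X -> \bar R}) (theta : R) (E Omega : set X) :
  0 <= perimeter mu theta E Omega.
Proof.
apply: integral_ge0 => x _; apply: integral_ge0 => y _.
rewrite mule_ge0// inve_ge0 mule_ge0 ?lee_fin ?powR_ge0//.
by rewrite adde_ge0// outer_measure_ge0.
Qed.

Section isoperimetric.
Context {R : realType}.
Variables (Cmu C0 Q theta C tau q : R) (n : nat).
Hypotheses (Cmu1 : (1 <= Cmu)%R) (C01 : (1 <= C0)%R) (Q1 : (1 < Q)%R).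
Hypotheses (theta0 : (0 < theta)%R) (theta1 : (theta < 1)%R).
Hypotheses (C1 : (1 <= C)%R) (tau1 : (1 <= tau)%R) (tau_n : (5 * tau <= 2 ^+ n)%R).
Hypotheses (q1 : (1 <= q)%R) (qQ : (q <= Q / (Q - theta))%R).

(* If [sigma <= 1] is the total relative mass of the balls and [E] is the sum of
   [mu B_i / r_i ^ theta], the lower mass bound gives
   [r_i ^ theta <= K sigma ^ (theta / Q)], hence
   [b sigma <= K sigma ^ (theta / Q) E]. *)
Let mass_power (b s K E : R) : (0 < b)%R -> (0 <= s)%R -> (s <= b)%R ->
  (0 <= K)%R -> (0 <= E)%R ->
  (s <= K * (s / b) `^ (theta / Q) * E)%R ->
  ((s / b) `^ q^-1 <= K * E / b)%R.
Proof.
move=> b0 s0 sb K0 E0 sE.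
have q0 : (0 < q)%R by exact: lt_le_trans q1.
have [s_eq0|s_neq0] := eqVneq s 0%R.
  by rewrite s_eq0 mul0r powR0 ?invr_eq0 ?gt_eqF// divr_ge0 ?mulr_ge0// ltW.
have {}s0 : (0 < s)%R by rewrite lt_neqAle eq_sym s_neq0.
have sb0 : (0 < s / b)%R by rewrite divr_gt0.
have sb1 : (s / b <= 1)%R by rewrite ler_pdivrMr// mul1r.
have Q0 : (0 < Q)%R by exact: lt_trans Q1.
have Qt : (0 < Q - theta)%R by rewrite subr_gt0 (lt_trans theta1).
(* The upper bound on [q] says [1 - theta / Q <= 1 / q], and the base is at most 1. *)
apply: (@le_trans _ _ ((s / b) `^ (1 - theta / Q))%R).
  apply: ger_powR; first by rewrite sb0.
  have -> : (1 - theta / Q = (Q / (Q - theta))^-1)%R.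
    by rewrite invf_div mulrBl divff ?gt_eqF.
  by rewrite lef_pV2 ?posrE// divr_gt0.
have p0 : (0 < (s / b) `^ (theta / Q))%R by rewrite powR_gt0.
rewrite powRB; last by apply/implyP => _; rewrite gt_eqF.
rewrite powRr1 ?(ltW sb0)// ler_pdivrMr// ler_pdivrMr//.
rewrite (le_trans sE)//.
by rewrite [leRHS](_ : _ = K * (s / b) `^ (theta / Q) * E)%R//;
   move: (_ `^ _)%R => pw; field; rewrite gt_eqF.
Qed.

Context {X : pmetricType R}.
Variable mu : {outer_measure set X -> \bar R}.
Hypotheses (mu_reg : borel_regular mu) (mu_dbl : doubling mu Cmu).
Hypothesis mu_lmb : rel_lower_mass_bound mu C0 Q.
Hypothesis box : boxing_property mu theta C tau.

Let M := caratheodory_type mu.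

(** By [n] doublings the balls [5 tau B_i] weigh at most [Cmu^n] times the [B_i], so [U] in [B0] has
    mass at most [Cmu^n s], with [s] the mass of the union of the [B_i]. The lower mass bound in
    [tau B0] controls each radius by [s / b], and [mass_power] absorbs this into the boxing sum. *)
Lemma boxing_isoperimetric (U : set X) (x0 : X) (r0 b : R) :
  mu.-cara.-measurable U -> (0 < r0)%R ->
  mu (U `&` ball x0 r0) / mu (ball x0 r0) <= (2^-1)%:E ->
  mu (ball x0 (tau * r0)%R) = b%:E ->
  mu (U `&` ball x0 r0) `^ q^-1 <=
  (b `^ q^-1 * (Cmu ^+ n * tau * C0 * C * (1 - theta) * r0 `^ theta / b))%:E *
    perimeter mu theta U (ball x0 (tau * r0)%R).
Proof.
move=> mU r00 half bE.
have tau0 : (0 < tau)%R by exact: lt_le_trans tau1.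
have Cmun0 : (0 < Cmu ^+ n)%R by rewrite exprn_gt0// (lt_le_trans _ Cmu1).
have C00 : (0 < C0)%R by exact: lt_le_trans C01.
have Q0 : (0 < Q)%R by exact: lt_trans Q1.
have q0 : (0 < q)%R by exact: lt_le_trans q1.
have tr0 : (0 < tau * r0)%R by rewrite mulr_gt0.
have b0 : (0 < b)%R by rewrite -lte_fin -bE; exact: (mu_ball_gt0 mu_dbl).
set P := perimeter _ _ _ _.
have P0 : 0 <= P by exact: perimeter_ge0.
have K0 : (0 < b `^ q^-1 *
    (Cmu ^+ n * tau * C0 * C * (1 - theta) * r0 `^ theta / b))%R.
  rewrite mulr_gt0 ?powR_gt0// divr_gt0// !mulr_gt0 ?powR_gt0 ?subr_gt0//.
  exact: lt_le_trans C1.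
have [Poo|Pfin] := eqVneq P +oo; first by rewrite Poo gt0_muley ?lte_fin// leey.
have {}Pfin : P \is a fin_num by rewrite ge0_fin_numE// ltey.
have [I [c [N [Z [triv [_ Z0] cover inside sumP]]]]] :=
  box mU r00 half.
rewrite -/P in sumP.
pose r i : R := (2 ^- N i * r0)%R.
pose B i : set M := ball (c i) (r i).
have r_gt0 i : (0 < r i)%R by rewrite mulr_gt0// invr_gt0 exprn_gt0.
have rle i : (r i <= tau * r0)%R.
  rewrite /r ler_pM2r// (le_trans _ tau1)// invf_le1 ?exprn_gt0//.
  by rewrite exprn_ege1// ler1n.
(* The lower mass bound asks for the centre in the large ball; it lies in its own ball, hence in
   [tau B0]. *)
have ctr i : I i -> ball x0 (tau * r0) (c i).
  move=> Ii; apply: inside; exists i => //; apply/mem_ball.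
  by rewrite mdistxx; exact: r_gt0.
pose S := mu (\bigcup_(i in I) B i).
have SE : S = \sum_(i <oo | i \in I) mu (B i).
  apply: (@measure_bigcup _ _ _ (mu : {measure set M -> \bar R}) I B) => // i _.
  exact: measurable_mball.
have S0 : 0 <= S by exact: outer_measure_ge0.
have Sb : S <= b%:E by rewrite -bE; exact: le_outer_measure.
have Sfin : S \is a fin_num by rewrite ge0_fin_numE// (le_lt_trans Sb)// ltry.
pose s := fine S.
have s0 : (0 <= s)%R by exact: fine_ge0.
have sE : S = s%:E by rewrite fineK.
have sb : (s <= b)%R by rewrite -lee_fin -sE.
have US : mu (U `&` ball x0 r0) <= (Cmu ^+ n * s)%:E.
  rewrite EFinM -sE SE -nneseriesZl ?lee_fin ?(ltW Cmun0)//.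
  apply: le_trans (le_outer_measure mu _ _ cover) _.
  apply: le_trans (outer_measureU2 mu _ _) _.
  rewrite Z0 add0e bigcup_mkcond eseries_mkcond.
  apply: le_trans (outer_measure_sigma_subadditive mu _) _.
  apply: lee_nneseries => [*|i _]; first exact: outer_measure_ge0.
  case: ifPn => Ii; last by rewrite outer_measure0.
  apply: (mu_ball_expand Cmu1 mu_dbl) => //.
  by rewrite ler_pM2r// r_gt0.
have Eb i : I i -> mu (B i) / (r i `^ theta)%:E = (fine (mu (B i)) / r i `^ theta)%:E.
  move=> Ii; rewrite -(fineK (mu_ball_fin_num Cmu1 mu_dbl _ _)).
  by rewrite inver gt_eqF ?powR_gt0.
pose E := \sum_(i <oo | i \in I) (mu (B i) / (r i `^ theta)%:E).
have term0 i : 0 <= mu (B i) / (r i `^ theta)%:E.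
  by rewrite mule_ge0 ?outer_measure_ge0// inve_ge0 lee_fin powR_ge0.
have EP : E <= (C * (1 - theta))%:E * P.
  rewrite /E nneseries_esum//; move: sumP.
  by rewrite (_ : [set x | x \in I] = I)//; apply/seteqP; split=> i /=; rewrite inE.
pose K := (tau * C0 * r0 `^ theta)%R.
have K_ge0 : (0 <= K)%R by rewrite !mulr_ge0 ?powR_ge0// ltW.
have rK i : I i -> (r i `^ theta <= K * (s / b) `^ (theta / Q))%R.
  move=> Ii; have := mu_lmb (r_gt0 i) (rle i) (ctr i Ii).
  have BS : mu (ball (c i) (r i)) <= s%:E.
    by rewrite -sE; apply: le_outer_measure => y yB; exists i.
  have Bs : mu (ball (c i) (r i)) * b^-1%:E <= s%:E * b^-1%:E.
    by apply: lee_wpmul2r; rewrite ?lee_fin ?invr_ge0 ?(ltW b0).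
  rewrite bE inver gt_eqF// => /le_trans /(_ Bs).
  rewrite -EFinM lee_fin ler_pdivrMl// => lmb.
  (* The power [theta / Q] of the lower mass bound turns the exponent [Q] of the radius into
     [theta]. *)
  have : ((r i / (tau * r0)) `^ theta <= (C0 * (s / b)) `^ (theta / Q))%R.
    have -> : ((r i / (tau * r0)) `^ theta =
        ((r i / (tau * r0)) `^ Q) `^ (theta / Q))%R.
      by rewrite -powRrM [(Q * _)%R]mulrC divfK ?gt_eqF.
    apply: ge0_ler_powR => //; first by rewrite divr_ge0 ?ltW.
      by rewrite nnegrE powR_ge0.
    by rewrite nnegrE mulr_ge0 ?divr_ge0// ltW.
  rewrite powRM ?divr_ge0 ?invr_ge0 ?(ltW (r_gt0 i)) ?(ltW tr0)//.
  rewrite -powR_inv1 ?(ltW tr0)// powRAC powR_inv1 ?powR_ge0//.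
  rewrite ler_pdivrMr ?powR_gt0// => /le_trans; apply.
  rewrite powRM ?(ltW C00) ?divr_ge0 ?(ltW b0)//.
  rewrite powRM ?(ltW tau0) ?(ltW r00)//.
  rewrite [leRHS](_ : _ = C0 * (s / b) `^ (theta / Q) * (tau * r0 `^ theta))%R; last first.
    by rewrite /K; ring.
  (* As [C0] and [tau] are at least 1, their powers [theta / Q] and [theta] are at most [C0] and
     [tau], which keeps these factors independent of [theta]. *)
  apply: ler_pM; rewrite ?mulr_ge0 ?powR_ge0//.
  - rewrite ler_wpM2r ?powR_ge0//; apply: ler1_powR => //.
    by rewrite ler_pdivrMr// mul1r ltW// (lt_trans theta1).
  - by rewrite ler_wpM2r ?powR_ge0//; apply: ler1_powR => //; exact: ltW.
have SE' : s%:E <= (K * (s / b) `^ (theta / Q))%:E * E.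
  rewrite -sE SE /E -nneseriesZl ?lee_fin ?mulr_ge0 ?powR_ge0//.
  apply: lee_nneseries => [*|i]; first exact: outer_measure_ge0.
  rewrite inE => Ii; rewrite Eb// -{1}(fineK (mu_ball_fin_num Cmu1 mu_dbl _ _)).
  rewrite -EFinM lee_fin mulrCA ler_peMr ?fine_ge0 ?outer_measure_ge0//.
  by rewrite ler_pdivlMr ?powR_gt0// mul1r; exact: rK.
pose p := fine P.
have PE : P = p%:E by rewrite fineK.
have p0 : (0 <= p)%R by exact: fine_ge0.
have sP : (s <= K * (s / b) `^ (theta / Q) * (C * (1 - theta) * p))%R.
  rewrite -lee_fin (le_trans SE')// [leRHS]EFinM.
  apply: lee_wpmul2l; first by rewrite lee_fin mulr_ge0 ?powR_ge0.
  by rewrite EFinM -PE.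
have E0 : (0 <= C * (1 - theta) * p)%R.
  by rewrite !mulr_ge0// ?subr_ge0 ?ltW// (lt_le_trans _ C1).
have final := mass_power b0 s0 sb K_ge0 E0 sP.
apply: (@le_trans _ _ ((Cmu ^+ n * s)%:E `^ q^-1)).
  apply: gt0_ler_poweR => //; first by rewrite invr_ge0 ltW.
  - by rewrite in_itv/= leey outer_measure_ge0.
  - by rewrite in_itv/= leey lee_fin mulr_ge0// ltW.
rewrite poweR_EFin PE -EFinM lee_fin.
have -> : (Cmu ^+ n * s = Cmu ^+ n * (b * (s / b)))%R.
  by rewrite [(b * _)%R]mulrC divfK ?gt_eqF.
rewrite powRM ?(ltW Cmun0)//; last by rewrite mulr_ge0 ?divr_ge0// ltW.
rewrite powRM ?(ltW b0) ?divr_ge0 ?(ltW b0)//.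
rewrite [leRHS](_ : _ = Cmu ^+ n * (b `^ q^-1 * (K * (C * (1 - theta) * p) / b)))%R; last first.
  by rewrite /K; ring.
(* Likewise [(Cmu^n)^(1/q) <= Cmu^n] removes the dependence on [q]. *)
apply: ler_pM; rewrite ?mulr_ge0 ?powR_ge0//.
  by apply: ler1_powR; rewrite ?exprn_ege1// invf_le1.
by rewrite ler_wpM2l ?powR_ge0.
Qed.

End isoperimetric.

(** * Existence of a median *)

Section median.
Context {R : realType} (d : measure_display) (T : measurableType d).
Variables (m : {measure set T -> \bar R}) (D : set T) (v : T -> R).
Hypotheses (mD : measurable D) (mv : measurable_fun setT v).
Hypotheses (D0 : 0 < m D) (Doo : m D < +oo).

Let h := (2^-1)%:E * m D.

Let mDfin : m D \is a fin_num. Proof. by rewrite ge0_fin_numE. Qed.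

Let h_lt : h < m D.
Proof.
move: D0; rewrite /h -(fineK mDfin) -EFinM !lte_fin => m0.
by rewrite gtr_pMl// invf_lt1// ltr1n.
Qed.

Let bigcup_le_half (F : nat -> set T) : (forall n, measurable (F n)) ->
  nondecreasing_seq F -> (forall n, m (F n) <= h) -> m (\bigcup_n F n) <= h.
Proof.
move=> mF ndF Fh.
have muF := @nondecreasing_cvg_mu _ _ _ m F mF (bigcupT_measurable _ mF) ndF.
rewrite -(cvg_lim _ muF)//; apply: lime_le; last exact: nearW.
by apply/cvg_ex; exists (m (\bigcup_n F n)).
Qed.

Let up t := D `&` [set x | (t < v x)%R].
Let dn t := D `&` [set x | (v x <= t)%R].

Let mup t : measurable (up t).
Proof.
by apply: measurableI => //; rewrite -[X in measurable X]setTI;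
   exact: measurable_fun_ltr.
Qed.

Let mdn t : measurable (dn t).
Proof.
by apply: measurableI => //; rewrite -[X in measurable X]setTI;
   exact: measurable_fun_ler.
Qed.

Let up_nonincreasing s t : (s <= t)%R -> up t `<=` up s.
Proof. by move=> st x [Dx /=] tx; split => //=; exact: le_lt_trans tx. Qed.

Let dn_le t : ~ m (up t) <= h -> m (dn t) <= h.
Proof.
move=> /negP; rewrite -ltNge => hup.
have DE : m D = m (up t) + m (dn t).
  rewrite -measureU//; last first.
    by rewrite -subset0 => x [[_ /= tx] [_ /=]]; rewrite leNgt tx.
  congr (m _); apply/seteqP; split => x; last by case=> -[].
  by move=> Dx; have [xt|xt] := leP (v x) t; [right|left].
have upfin : m (up t) \is a fin_num.
  by rewrite ge0_fin_numE// (le_lt_trans _ Doo)// le_measure ?inE//; exact: subIsetl.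
have dnfin : m (dn t) \is a fin_num.
  by rewrite ge0_fin_numE// (le_lt_trans _ Doo)// le_measure ?inE//; exact: subIsetl.
move: hup DE; rewrite /h -(fineK upfin) -(fineK dnfin) -(fineK mDfin) -EFinD.
by rewrite -EFinM lte_fin lee_fin => hup [DE]; lra.
Qed.

(** The median is the infimum of the levels [t] with [m (up t) <= h]. Below it [dn_le] bounds the
    other side, and continuity from below carries both bounds to the strict inequalities. *)
Lemma median_exists : exists c, m (D `&` [set x | (c < v x)%R]) <= h /\
  m (D `&` [set x | (v x < c)%R]) <= h.
Proof.
pose A := [set t | m (up t) <= h].
(* Otherwise every [dn n] has measure at most [h], hence so has their union [D], against [h < m D].
   The lower bound of [A] follows in the same way from the sets [up (- n)]. *)
have A0 : A !=set0.
  apply: contrapT => /set0P/negP; rewrite negbK => /eqP A0.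
  have : m (\bigcup_n dn n%:R) <= h.
    apply: bigcup_le_half => // [i j ij|n].
      by apply/subsetPset => x [Dx /= xi]; split => //=;
         rewrite (le_trans xi)// ler_nat.
    by apply: dn_le => An; have : A n%:R by []; rewrite A0.
  rewrite (_ : \bigcup_n _ = D) ?leNgt ?h_lt//; apply/seteqP; split.
    by move=> x [n _ []].
  move=> x Dx; exists (Num.bound `|v x|) => //; split => //=.
  by apply/ltW/(le_lt_trans (ler_norm _))/archi_boundP.
have Ab : has_lbound A.
  apply: contrapT => Ab.
  have : m (\bigcup_n up (- n%:R)%R) <= h.
    apply: bigcup_le_half => // [i j ij|n].
      by apply/subsetPset/up_nonincreasing; rewrite lerN2 ler_nat.
    have /existsNP[t /not_implyP[At /negP]] : ~ lbound A (- n%:R)%R.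
      by move=> lA; apply: Ab; exists (- n%:R)%R.
    rewrite -ltNge => tn; apply: le_trans At; apply: le_measure; rewrite ?inE//.
    exact/up_nonincreasing/ltW.
  rewrite (_ : \bigcup_n _ = D) ?leNgt ?h_lt//; apply/seteqP; split.
    by move=> x [n _ []].
  move=> x Dx; exists (Num.bound `|v x|) => //; split => //=.
  rewrite ltrNl; apply: le_lt_trans (archi_boundP _) => //.
  by rewrite -normrN ler_norm.
have hA : has_inf A by [].
exists (inf A); split.
- have -> : D `&` [set x | (inf A < v x)%R] =
      \bigcup_n up (inf A + n.+1%:R^-1)%R.
    apply/seteqP; split => x.
      move=> [Dx /= cx]; pose n := Num.bound (v x - inf A)^-1%R.
      exists n => //; split => //=; rewrite addrC -ltrBrDr.
      rewrite invf_plt ?posrE ?subr_gt0//.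
      apply: (@lt_le_trans _ _ n%:R); last by rewrite ler_nat.
      by apply: archi_boundP; rewrite invr_ge0 subr_ge0 ltW.
    by move=> [n _ [Dx /= cx]]; split => //=; apply: le_lt_trans cx; rewrite lerDl.
  apply: bigcup_le_half => // [i j ij|n].
    apply/subsetPset/up_nonincreasing.
    by rewrite lerD2l lef_pV2 ?posrE// ler_nat.
  have n0 : (0 < n.+1%:R^-1 :> R)%R by rewrite invr_gt0.
  have [t At tn] := inf_adherent n0 hA.
  apply: le_trans At; apply: le_measure; rewrite ?inE//.
  exact/up_nonincreasing/ltW.
- have -> : D `&` [set x | (v x < inf A)%R] =
      \bigcup_n dn (inf A - n.+1%:R^-1)%R.
    apply/seteqP; split => x.
      move=> [Dx /= cx]; pose n := Num.bound (inf A - v x)^-1%R.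
      exists n => //; split => //=; rewrite lerBrDr addrC -lerBrDr.
      apply/ltW; rewrite invf_plt ?posrE ?subr_gt0//.
      apply: (@lt_le_trans _ _ n%:R); last by rewrite ler_nat.
      by apply: archi_boundP; rewrite invr_ge0 subr_ge0 ltW.
    move=> [n _ [Dx /= cx]]; split => //=; apply: le_lt_trans cx _.
    by rewrite ltrBlDr ltrDl invr_gt0.
  apply: bigcup_le_half => // [i j ij|n].
    apply/subsetPset => x [Dx /= xi]; split => //=; apply: le_trans xi _.
    by rewrite lerD2l lerN2 lef_pV2 ?posrE// ler_nat.
  apply: dn_le => An; have /(ge_inf Ab) : A (inf A - n.+1%:R^-1)%R by [].
  by rewrite leNgt ltrBlDr ltrDl invr_gt0 ltr0n.
Qed.

End median.

(** * Compactness of closures of balls *)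

Section compact_balls.
Context {R : realType} {X : completeMetricType R}.
Variables (mu : {outer_measure set X -> \bar R}) (Cmu C0 Q : R).
Hypotheses (Cmu1 : (1 <= Cmu)%R) (C01 : (1 <= C0)%R).
Hypotheses (mu_reg : borel_regular mu) (mu_dbl : doubling mu Cmu).
Hypothesis mu_lmb : rel_lower_mass_bound mu C0 Q.

Let ultra_bigcup (F : set_system X) (B : X -> set X) (s : seq X) :
  UltraFilter F -> F (\bigcup_(y in [set` s]) B y) -> exists y, F (B y).
Proof.
move=> FU; elim: s => [|z s IHs] Fs.
  by exfalso; apply: (@filter_not_empty _ F); apply: filterS Fs => y [].
have [Fz|Fz] := in_ultra_setVsetC (B z) FU; first by exists z.
apply: IHs; apply: filterS (filterI Fs Fz) => w [[y /=]].
rewrite inE => /predU1P[->//|ys Bw _]; by exists y.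
Qed.

(** An ultrafilter on the closure contains some member of every finite net of balls, so it is
    Cauchy; it converges by completeness, and the limit stays in the closed set. *)
Lemma compact_closure_ball (x : X) (r : R) : compact (closure (ball x r)).
Proof.
rewrite compact_ultra => F FU Fcl.
have Fcauchy : cauchy F.
  apply: cauchy_exP => e e0.
  (* The larger radius makes the net cover the closure too. *)
  have [s sr] := totally_bounded_ball Cmu1 C01 mu_reg mu_dbl mu_lmb x (r + 1)%R e0.
  apply: (@ultra_bigcup F (fun y => ball y e) s) => //; apply: filterS Fcl.
  apply: subset_trans sr; apply: closure_ball_subset; by rewrite ltrDl.
have Fp : F --> lim F by apply: cauchy_cvg.
exists (lim F); split => //.
exact: (@closed_cvg _ _ F _ id _ (@closed_closure _ (ball x r)) Fcl).
Qed.

End compact_balls.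

(** * Poincare inequality on a fixed ball *)

Lemma BBM_quotient_ge0 {R : realType} {X : pmetricType R}
    (mu : {outer_measure set X -> \bar R}) (theta : R) (u : X -> R) (x y : X) :
  0 <= BBM_quotient mu theta u x y.
Proof.
rewrite /BBM_quotient; case: ifP => // _.
by rewrite mule_ge0// inve_ge0 mule_ge0 ?lee_fin ?powR_ge0// outer_measure_ge0.
Qed.

Section poincare.
Context {R : realType} {X : pmetricType R}.
Variables (mu : {outer_measure set X -> \bar R}).
Variables (Cmu C0 Q theta C tau : R) (n : nat).
Hypotheses (Cmu1 : (1 <= Cmu)%R) (C01 : (1 <= C0)%R) (Q1 : (1 < Q)%R).
Hypotheses (theta0 : (0 < theta)%R) (theta1 : (theta < 1)%R).
Hypotheses (C1 : (1 <= C)%R) (tau1 : (1 <= tau)%R) (tau_n : (5 * tau <= 2 ^+ n)%R).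
Hypotheses (mu_reg : borel_regular mu) (mu_dbl : doubling mu Cmu).
Hypothesis mu_lmb : rel_lower_mass_bound mu C0 Q.
Hypothesis box : boxing_property mu theta C tau.
Variables (x0 : X) (r : R).
Hypothesis r0 : (0 < r)%R.

Let M := caratheodory_type mu.
Let B : set M := ball x0 r.
Let Om : set M := ball x0 (tau * r)%R.
Let b := fine (mu Om).
Let A := (Cmu ^+ n * tau * C0 * C * (1 - theta) * r `^ theta)%R.

Let energy (v : X -> R) : \bar R :=
  cint mu Om (fun x => cint mu Om (BBM_quotient mu theta v x)).

Let tau0 : (0 < tau)%R. Proof. exact: lt_le_trans tau1. Qed.

Let b0 : (0 < b)%R.
Proof. by apply: (fine_mu_ball_gt0 Cmu1 mu_dbl); rewrite mulr_gt0. Qed.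

Let A0 : (0 <= A)%R.
Proof.
by rewrite !mulr_ge0 ?powR_ge0 ?exprn_ge0 ?subr_ge0 ?(ltW theta1)// ?(ltW tau0)//;
  [exact: le_trans Cmu1|exact: le_trans C01|exact: le_trans C1].
Qed.

Let BOm : B `<=` Om.
Proof. by apply: ball_subset_radius; rewrite ler_peMl// ltW. Qed.

Let mB : measurable B. Proof. exact: measurable_mball. Qed.
Let mOm : measurable Om. Proof. exact: measurable_mball. Qed.

(** [layer_cake_le] on [B], with [G] supplied by the isoperimetric inequality for the superlevel
    sets. The 4 is a 2 from the layer cake times a 2 from coarea, and [b] is the [q]-th power of
    [b^(1/q)]. *)
Lemma positive_part_le (v : M -> R) (q e : R) : measurable_fun setT v ->
  (forall t, (0 < t)%R ->
    mu (B `&` [set x | (t <= v x)%R]) <= (2^-1)%:E * mu B) ->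
  (1 <= q)%R -> (q <= Q / (Q - theta))%R -> energy v = e%:E ->
  cint mu B (fun x => (Num.max (v x) 0 `^ q)%:E) <=
    (b * (4 * (A / b) * e) `^ q)%:E.
Proof.
move=> mv vhalf q1 qQ ve.
have q0 : (0 < q)%R by exact: lt_le_trans q1.
have e0 : (0 <= e)%R.
  rewrite -lee_fin -ve; apply: integral_ge0 => x _; apply: integral_ge0 => y _.
  exact: BBM_quotient_ge0.
pose m := sigma_finite_copy (m := (mu : {measure set M -> \bar R}))
  (sigma_finite_mu Cmu1 mu_reg mu_dbl).
pose K := (b `^ q^-1 * (A / b))%R.
have K0 : (0 <= K)%R by rewrite mulr_ge0 ?powR_ge0// divr_ge0// ltW.
pose P := @perimeter_superlevel R X mu theta Om v.
have mP : measurable_fun setT P.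
  exact: (measurable_perimeter_superlevel Cmu1 C01 mu_reg mu_dbl mu_lmb).
have P0 t : 0 <= P t by exact: perimeter_ge0.
pose G t := K%:E * P t.
have mG : measurable_fun setT G by exact: measurable_funeM.
have G0 t : 0 <= G t by rewrite mule_ge0.
have vG t : (0 < t)%R -> m (B `&` [set x | (t <= v x)%R]) `^ q^-1 <= G t.
  (* Cut with [Om] and not with [B]: the perimeter is taken in [Om], and the trace on [B] is the
     same. *)
  move=> t0; pose U : set M := Om `&` [set x | (t <= v x)%R].
  have UB : B `&` [set x | (t <= v x)%R] = U `&` B.
    apply/seteqP; split => x; first by move=> [Bx tx]; split => //; split => //; exact: BOm.
    by move=> [[_ tx] Bx].
  rewrite UB; apply: (boxing_isoperimetric Cmu1 C01 Q1 theta0 theta1 C1 tau1 tau_n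
    q1 qQ mu_reg mu_dbl mu_lmb box) => //;
    last by rewrite fineK ?(mu_ball_fin_num Cmu1 mu_dbl).
    apply: measurableI => //; rewrite -[X in measurable X]setTI.
    exact: measurable_fun_ler.
  have Bfin : mu B \is a fin_num by exact: (mu_ball_fin_num Cmu1 mu_dbl).
  have Bgt0 : (0 < fine (mu B))%R by exact: (fine_mu_ball_gt0 Cmu1 mu_dbl).
  have := vhalf t t0; rewrite UB -/B -(fineK Bfin) => UBh.
  apply: (@le_trans _ _ ((2^-1)%:E * (fine (mu B))%:E / (fine (mu B))%:E)).
    by apply: lee_wpmul2r => //; rewrite inve_ge0 lee_fin ltW.
  by rewrite inver gt_eqF// -!EFinM lee_fin mulfK ?gt_eqF.
have := @layer_cake_le _ _ _ m B v q G mB mv q1 mG G0 vG.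
move=> /le_trans; apply.
apply: (@le_trans _ _ ((4 * K * e)%:E `^ q)).
  apply: gt0_ler_poweR; first exact: ltW.
  - by rewrite in_itv/= leey mule_ge0//; exact: integral_ge0.
  - by rewrite in_itv/= leey lee_fin (mulr_ge0 (mulr_ge0 _ K0) e0).
  rewrite /G ge0_integralZl//.
  have := coarea_perimeter Cmu1 C01 mu_reg mu_dbl mu_lmb theta0 mOm mv.
  rewrite -/(energy v) ve -EFinM => Pe.
  rewrite (_ : 4 * K * e = 2 * (K * (2 * e)))%R; last by ring.
  rewrite [leRHS]EFinM; apply: lee_wpmul2l => //; rewrite [leRHS]EFinM.
  by apply: lee_wpmul2l => //; rewrite lee_fin.
rewrite poweR_EFin lee_fin /K.
rewrite (_ : 4 * _ * e = b `^ q^-1 * (4 * (A / b) * e))%R; last by ring.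
rewrite powRM ?powR_ge0//; last first.
  by rewrite (mulr_ge0 (mulr_ge0 _ (divr_ge0 A0 (ltW b0))) e0).
by rewrite -powRrM mulVf ?gt_eqF// powRr1// ltW.
Qed.

Let energyB (w : X -> R) c : energy (fun x => w x - c)%R = energy w.
Proof.
congr (cint mu Om _); apply/funext => x; congr (cint mu Om _); apply/funext => y.
by rewrite /BBM_quotient opprB addrA subrK.
Qed.

Let energyN (w : X -> R) c : energy (fun x => c - w x)%R = energy w.
Proof.
congr (cint mu Om _); apply/funext => x; congr (cint mu Om _); apply/funext => y.
rewrite /BBM_quotient distrC (_ : c - w y - (c - w x) = w x - w y)%R//.
by ring.
Qed.

Let powR_sum3 (q a1 a2 a3 : R) : (1 <= q)%R ->
  (0 <= a1)%R -> (0 <= a2)%R -> (0 <= a3)%R ->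
  ((a1 + a2 + a3) `^ q <= 3 `^ q * (a1 `^ q + a2 `^ q + a3 `^ q))%R.
Proof.
move=> q1 a10 a20 a30; have q0 : (0 <= q)%R by exact: le_trans q1.
pose s := Num.max a1 (Num.max a2 a3).
have s0 : (0 <= s)%R by rewrite le_max a10.
apply: (@le_trans _ _ ((3 * s) `^ q)%R).
  apply: ge0_ler_powR; rewrite ?nnegrE ?addr_ge0 ?mulr_ge0//.
  have : (a1 <= s)%R by rewrite le_max lexx.
  have : (a2 <= s)%R by rewrite !le_max lexx orbT.
  have : (a3 <= s)%R by rewrite !le_max lexx !orbT.
  lra.
rewrite powRM// ler_wpM2l ?powR_ge0// /s.
have p1 := powR_ge0 a1 q; have p2 := powR_ge0 a2 q; have p3 := powR_ge0 a3 q.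
by case: (leP a2 a3) => _; case: (leP a1 _) => _; lra.
Qed.

(** With a median [c], [|w - wB|] is at most the sum of the positive parts of [w - c] and [c - w]
    and of [|c - wB|]. [positive_part_le] with exponent [q] bounds the first two; with exponent 1 it
    bounds the mean of [|w - c|], hence the third. *)
Lemma BBM_poincare_measurable (w : M -> R) (q e : R) :
  measurable_fun setT w ->
  integrable (mu : set M -> \bar R) B (EFin \o w) ->
  (1 <= q)%R -> (q <= Q / (Q - theta))%R -> energy w = e%:E ->
  (avg mu B (fun x => (`|w x - fine (avg mu B (EFin \o w))| `^ q)%:E)) `^ q^-1 <=
  (12 * Cmu ^+ n * (4 * (A / b) * e))%:E.
Proof.
move=> mw iw q1 qQ we.
have q0 : (0 < q)%R by exact: lt_le_trans q1.
have e0 : (0 <= e)%R.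
  rewrite -lee_fin -we; apply: integral_ge0 => x _; apply: integral_ge0 => y _.
  exact: BBM_quotient_ge0.
pose m : {measure set M -> \bar R} := mu.
pose bt := fine (mu B).
have bt0 : (0 < bt)%R by exact: (fine_mu_ball_gt0 Cmu1 mu_dbl).
have Bfin : mu B \is a fin_num by exact: (mu_ball_fin_num Cmu1 mu_dbl).
have btE : mu B = bt%:E by rewrite fineK.
have [c [cup cdn]] := @median_exists _ _ _ m B w mB mw
  (mu_ball_gt0 mu_dbl _ r0) (ltac:(by rewrite -ge0_fin_numE)).
pose k := (Cmu ^+ n)%R.
have k1 : (1 <= k)%R by rewrite exprn_ege1.
(* Since [tau <= 5 tau <= 2^n], [n] doublings also carry [B] to [Om]. *)
have bk : (b <= k * bt)%R.
  rewrite -lee_fin EFinM -btE fineK ?(mu_ball_fin_num Cmu1 mu_dbl)//.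
  apply: (mu_ball_expand Cmu1 mu_dbl) => //; rewrite ler_pM2r//.
  by apply: le_trans tau_n; rewrite ler_peMl// ?(ltW tau0)// ler1n.
pose L := (4 * (A / b) * e)%R.
have L0 : (0 <= L)%R by exact: (mulr_ge0 (mulr_ge0 _ (divr_ge0 A0 (ltW b0))) e0).
pose vp (x : M) := (w x - c)%R.
pose vn (x : M) := (c - w x)%R.
have mvp : measurable_fun setT vp by exact: measurable_funB.
have mvn : measurable_fun setT vn by exact: measurable_funB.
have vp_le p : (1 <= p)%R -> (p <= Q / (Q - theta))%R ->
    cint mu B (fun x => (Num.max (vp x) 0 `^ p)%:E) <= (b * L `^ p)%:E.
  move=> p1 pQ; apply: (positive_part_le mvp _ p1 pQ (etrans (energyB w c) we)).
  move=> t t0; apply: le_trans cup; apply: le_outer_measure => x [Bx /= tx].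
  by split => //=; rewrite -subr_gt0; exact: lt_le_trans tx.
have vn_le p : (1 <= p)%R -> (p <= Q / (Q - theta))%R ->
    cint mu B (fun x => (Num.max (vn x) 0 `^ p)%:E) <= (b * L `^ p)%:E.
  move=> p1 pQ; apply: (positive_part_le mvn _ p1 pQ (etrans (energyN w c) we)).
  move=> t t0; apply: le_trans cdn; apply: le_outer_measure => x [Bx /= tx].
  by split => //=; rewrite -subr_gt0; exact: lt_le_trans tx.
have mmax (v : M -> R) p : measurable_fun setT v ->
    measurable_fun B (fun x => (Num.max (v x) 0 `^ p)%:E).
  move=> mv; apply: measurable_funTS; apply/measurable_EFinP.
  apply: (measurableT_comp (measurable_powR p)).
  by apply: measurable_maxr => //; exact: measurable_cst.
have max_ge0 (v : M -> R) p x : 0 <= (Num.max (v x) 0 `^ p)%:E.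
  by rewrite lee_fin powR_ge0.
have absE x : `|w x - c|%R = (Num.max (vp x) 0 + Num.max (vn x) 0)%R.
  rewrite /vp /vn; have [wc|wc] := leP (w x) c.
    by rewrite max_r ?subr_le0// max_l ?subr_ge0// add0r distrC ger0_norm ?subr_ge0.
  by rewrite max_l ?subr_ge0 ?(ltW wc)// max_r ?subr_le0 ?(ltW wc)// addr0 ger0_norm// subr_ge0 ltW.
pose wB := fine (avg mu B (EFin \o w)).
have wBc : (`|c - wB| <= 2 * k * L)%R.
  have qmin : (1 <= Q / (Q - theta))%R by exact: le_trans qQ.
  have := leeD (vp_le 1%R (lexx _) qmin) (vn_le 1%R (lexx _) qmin).
  rewrite /cint -ge0_integralD//; [|exact: mmax|exact: mmax].
  rewrite powRr1// -EFinD => intc.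
  have ifin : \int[m]_(x in B) (w x)%:E \is a fin_num by exact: integrable_fin_num.
  pose i := fine (\int[m]_(x in B) (w x)%:E).
  have wBE : wB = (i / bt)%R.
    rewrite /wB /avg /cint btE inver gt_eqF//.
    by rewrite -[X in _ * X](fineK ifin) -EFinM/= mulrC.
  have icst : integrable m B (EFin \o cst c).
    apply: measurable_bounded_integrable => //; first by rewrite -ge0_fin_numE.
    by exists `|c|%R; split => // t tc x _ /=; exact: ltW.
  have : (`|i - c * bt| <= 2 * b * L)%R.
    rewrite -lee_fin; apply: le_trans (_ : \int[m]_(x in B) `|(w x - c)%:E| <= _).
      have -> : `|i - c * bt|%:E = `|\int[m]_(x in B) (w x - c)%:E|.
        rewrite integralB_EFin// integral_cst//= -[X in _ * X]/(mu B) btE.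
        by rewrite -(fineK ifin).
      apply: le_abse_integral => //.
      by apply/measurable_EFinP; apply: measurable_funTS.
    rewrite (_ : 2 * b * L = b * L + b * L)%R; last by ring.
    apply: le_trans intc; rewrite le_eqVlt; apply/orP; left; apply/eqP.
    apply: eq_integral => x _; rewrite /= absE EFinD !powRr1// le_max lexx orbT//.
  rewrite wBE => ic; rewrite distrC.
  have -> : (i / bt - c = (i - c * bt) / bt)%R by field; rewrite gt_eqF.
  rewrite normrM [`|bt^-1|%R]ger0_norm ?invr_ge0 ?(ltW bt0)// ler_pdivrMr//.
  have bL : (b * L <= k * bt * L)%R by rewrite ler_wpM2r.
  by apply: (le_trans ic); lra.
have Ineq : cint mu B (fun x => (`|w x - wB| `^ q)%:E) <=
    (bt * (12 * k * L) `^ q)%:E.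
  apply: (@le_trans _ _ (\int[m]_(x in B) ((3 `^ q)%:E *
     ((Num.max (vp x) 0 `^ q)%:E + (Num.max (vn x) 0 `^ q)%:E
       + (`|c - wB| `^ q)%:E)))).
    apply: ge0_le_integral => //.
    - apply: measurable_funTS; apply/measurable_EFinP.
      apply: (measurableT_comp (measurable_powR q)).
      apply: (@measurableT_comp _ _ _ _ _ _ (@Num.norm R R)) => //.
      exact: measurable_funB.
    - apply: measurable_funeM; apply: emeasurable_funD => //.
      by apply: emeasurable_funD; exact: mmax.
    move=> x _; rewrite -!EFinD -EFinM lee_fin.
    apply: le_trans (powR_sum3 q1 _ _ _) => //; rewrite ?le_max ?lexx ?orbT//.
    apply: ge0_ler_powR; rewrite ?nnegrE ?addr_ge0 ?le_max ?lexx ?orbT ?(ltW q0)//.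
    by rewrite -absE (_ : w x - wB = (w x - c) + (c - wB))%R ?ler_normD//; ring.
  rewrite ge0_integralZl//; first last.
  - by move=> x _; rewrite -!EFinD lee_fin !addr_ge0 ?powR_ge0.
  - apply: emeasurable_funD => //.
    by apply: emeasurable_funD; exact: mmax.
  rewrite ge0_integralD//; last 2 first.
  - by move=> x _; rewrite adde_ge0.
  - by apply: emeasurable_funD; exact: mmax.
  rewrite ge0_integralD//; [|exact: mmax|exact: mmax].
  rewrite integral_cst//= -[X in _ + _ * X]/(mu B) btE.
  apply: (@le_trans _ _ ((3 `^ q)%:E * ((b * L `^ q)%:E + (b * L `^ q)%:E
      + (`|c - wB| `^ q)%:E * bt%:E))).
    apply: lee_wpmul2l; first by rewrite lee_fin powR_ge0.
    by apply: leeD => //; apply: leeD; [exact: vp_le|exact: vn_le].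
  rewrite -[leLHS]/((3 `^ q * (b * L `^ q + b * L `^ q
      + `|c - wB| `^ q * bt))%:E) lee_fin.
  have k0 : (0 <= k)%R by exact: le_trans k1.
  have p2k : (2 * k <= (2 * k) `^ q)%R by apply: le1r_powR; lra.
  have pwB : (`|c - wB| `^ q <= (2 * k) `^ q * L `^ q)%R.
    rewrite -powRM//; last by lra.
    by apply: ge0_ler_powR; rewrite ?nnegrE ?(ltW q0)// mulr_ge0//; lra.
  have p2 : (2 <= 2 `^ q :> R)%R by apply: le1r_powR => //; rewrite ler1n.
  have L1 := powR_ge0 L q.
  (* The 3 comes from [powR_sum3]. The positive parts together, and the constant term, each
     contribute at most [bt (2 k L)^q], and [2 <= 2^q] absorbs the two contributions. *)
  rewrite (_ : 12 * k * L = 3 * (2 * (2 * k * L)))%R; last by ring.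
  rewrite powRM//; last by rewrite mulr_ge0// mulr_ge0//; lra.
  rewrite mulrCA ler_wpM2l ?powR_ge0// powRM//; last by rewrite mulr_ge0//; lra.
  rewrite [X in (_ <= _ * (_ * X))%R]powRM//; last by lra.
  set Lq := (L `^ q)%R in L1 pwB *; set kq := ((2 * k) `^ q)%R in p2k pwB *.
  apply: (@le_trans _ _ (bt * (2 * (kq * Lq)))%R); last first.
    rewrite ler_wpM2l ?(ltW bt0)// ler_wpM2r// mulr_ge0// /kq powR_ge0//.
  have h1 : (b * Lq <= k * bt * Lq)%R by rewrite ler_wpM2r.
  have h2 : (2 * k * (bt * Lq) <= kq * (bt * Lq))%R.
    by rewrite ler_wpM2r// mulr_ge0// ltW.
  have h3 : (`|c - wB| `^ q * bt <= kq * Lq * bt)%R by rewrite ler_wpM2r// ltW.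
  lra.
rewrite -/wB /avg btE inver gt_eqF//.
apply: (@le_trans _ _ (((12 * k * L) `^ q)%:E `^ q^-1)).
  apply: gt0_ler_poweR; first by rewrite invr_ge0 ltW.
  - rewrite in_itv/= leey mule_ge0 ?lee_fin ?invr_ge0 ?(ltW bt0)//.
    by apply: integral_ge0 => x _; rewrite lee_fin powR_ge0.
  - by rewrite in_itv/= leey lee_fin powR_ge0.
  apply: (@le_trans _ _ (bt^-1%:E * (bt * (12 * k * L) `^ q)%:E)).
    by apply: lee_wpmul2l => //; rewrite lee_fin invr_ge0 ltW.
  by rewrite -EFinM mulKf ?gt_eqF.
rewrite poweR_EFin lee_fin -powRrM mulfV ?gt_eqF// powRr1//.
exact: (mulr_ge0 (mulr_ge0 _ (le_trans ler01 k1)) L0).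
Qed.

Lemma BBM_poincare_ball (u : X -> R) (q : R) :
  integrable (mu : set M -> \bar R) Om (EFin \o u) ->
  (1 <= q)%R -> (q <= Q / (Q - theta))%R ->
  (avg mu B (fun x => (`|u x - fine (avg mu B (EFin \o u))| `^ q)%:E)) `^ q^-1 <=
  (48 * (Cmu ^+ n * Cmu ^+ n * tau * C0 * C) * (1 - theta) * r `^ theta)%:E *
    avg mu Om (fun x => cint mu Om (BBM_quotient mu theta u x)).
Proof.
have E0 : 0 <= energy u.
  by apply: integral_ge0 => x _; apply: integral_ge0 => y _; exact: BBM_quotient_ge0.
have bE : mu Om = b%:E by rewrite fineK; last exact: (mu_ball_fin_num Cmu1 mu_dbl).
have kn0 : (0 < Cmu ^+ n)%R by rewrite exprn_gt0// (lt_le_trans _ Cmu1).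
have K0 : (0 < 48 * (Cmu ^+ n * Cmu ^+ n * tau * C0 * C) * (1 - theta)
    * r `^ theta)%R.
  rewrite !mulr_gt0 ?powR_gt0 ?subr_gt0//.
    exact: lt_le_trans C01.
  exact: lt_le_trans C1.
move=> iu q1 qQ; rewrite [X in _ <= _ * X]/avg -/(energy u) bE inver gt_eqF//.
(* For infinite energy the right-hand side is infinite, its constant being positive. *)
have [->|Eoo] := eqVneq (energy u) +oo.
  by rewrite gt0_muley ?lte_fin ?invr_gt0// gt0_muley ?lte_fin// leey.
have Efin : energy u \is a fin_num by rewrite ge0_fin_numE// ltey.
rewrite -(fineK Efin) -!EFinM.
set uB := fine (avg mu B (EFin \o u)).
pose m : {measure set M -> \bar R} := mu.
(* Integrability makes [u] measurable on [Om] only. Its extension by a constant is measurable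
   everywhere and changes neither the energy nor the averages on [B]. *)
pose w : M -> R := patch (fun=> (point : measurableTypeR R)) Om u.
have wu x : Om x -> w x = u x by move=> Ox; rewrite /w patchE mem_set.
have wuB x : x \in B -> w x = u x by move=> /set_mem/BOm/wu.
have wE : energy w = energy u.
  apply: eq_integral => x /set_mem Ox; apply: eq_integral => y /set_mem Oy.
  by rewrite /BBM_quotient !wu.
have iw : integrable m B (EFin \o w).
  apply: (@eq_integrable _ _ _ m B mB (EFin \o u)).
    by move=> x xB; rewrite /= wuB.
  exact: integrableS mOm mB BOm iu.
have mw : measurable_fun setT w.
  apply/(@measurable_restrictT _ _ M (measurableTypeR R) _ _ mOm).
  by apply/measurable_EFinP; exact: (measurable_int m).
have := BBM_poincare_measurable mw iw q1 qQ (etrans wE (esym (fineK Efin))).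
have avgE (f g : X -> \bar R) : (forall x, x \in B -> f x = g x) ->
    avg mu B f = avg mu B g.
  by move=> fg; congr (_ * _); apply: eq_integral => x xB; exact: fg.
have -> : fine (avg mu B (EFin \o w)) = uB.
  by congr fine; apply: avgE => x xB; rewrite /= wuB.
rewrite (avgE _ (fun x => (`|u x - uB| `^ q)%:E)) => [|x xB]; last by rewrite wuB.
move=> /le_trans; apply; rewrite lee_fin le_eqVlt; apply/orP; left; apply/eqP.
by rewrite /A; ring.
Qed.

End poincare.

Local Close Scope ereal_scope.

(* C0 and Qd: the constant and the exponent of the relative lower mass bound,
   as functions of the doubling constant *)
Theorem corollary6p4 (R : realType) (C0 Qd : R -> R)
    (hC0 : forall K : R, 1 <= K -> 1 <= C0 K)
    (hQd : forall K : R, 1 <= K -> 1 < Qd K)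
    (Cmu C tau : R) (hCmu : 1 <= Cmu) (hC : 1 <= C) (htau : 1 <= tau) :
  exists C' tau' : R, [/\ 1 <= C', 1 <= tau' &
    forall (X : completeMetricType R) (mu : {outer_measure set X -> \bar R})
      (theta : R),
      borel_regular mu ->
      doubling mu Cmu ->
      rel_lower_mass_bound mu (C0 Cmu) (Qd Cmu) ->
      0 < theta -> theta < 1 ->
      boxing_property mu theta C tau ->
      forall q : R, 1 <= q -> q <= Qd Cmu / (Qd Cmu - theta) ->
        BBM_poincare mu theta q C' tau'].
Proof.
have C01 := hC0 _ hCmu; have Q1 := hQd _ hCmu.
(* Any [n >= 5 tau] will do, because [n <= 2^n]. *)
pose n := Num.bound (5 * tau).
have tau_n : 5 * tau <= 2 ^+ n.
  apply: (@le_trans _ _ n%:R); first apply/ltW/archi_boundP.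
    by rewrite mulr_ge0// (le_trans _ htau).
  by rewrite -natrX ler_nat ltnW// ltn_expl.
(* [48 = 12 * 4]; one [Cmu^n] comes from the enlarged boxing balls, the other from comparing [tau B]
   with [B]. *)
exists (48 * (Cmu ^+ n * Cmu ^+ n * tau * C0 Cmu * C)), tau; split => //.
  by rewrite mulr_ege1 ?ler1n// !mulr_ege1// exprn_ege1.
move=> X mu theta mu_reg mu_dbl mu_lmb theta0 theta1 box q q1 qQ x0 r u r0 uL1.
apply: (BBM_poincare_ball hCmu C01 Q1 theta0 theta1 hC htau tau_n mu_reg mu_dbl
  mu_lmb box r0 _ q1 qQ).
(* Local integrability gives integrability on [tau B], whose closure is compact by completeness. *)
apply: uL1; first exact: open_mball.
exact: (compact_closure_ball hCmu C01 mu_reg mu_dbl mu_lmb).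
Qed.
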